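(* Consider the linear-Gaussian filtering model, the vanilla ensemble Kalman--Bucy filter estimator $\overline{U}^{N,l}_{t+k_1\Delta_l}(Y)$ and its limit $\overline{U}^{l}_{t+k_1\Delta_l}(Y)$ as defined in the context. Assume (i) $\mu(A)<0$, where $\mu(B)$ is the largest eigenvalue of $\tfrac12(B+B^{\top})$; and (ii) there is a finite constant bounding $|P^l_{k\Delta_l}(j_1,j_2)|$ uniformly over all $(k,l)\in\mathbb{N}_0^2$ and $(j_1,j_2)\in\{1,\dots,d_x\}^2$. Then for any $(q,t,k_1,l)\in[1,\infty)\times\mathbb{N}_0^3$ there exists a constant $\mathsf{C}<+\infty$ such that for any $N\in\{2,3,\dots\}$, $$\mathbb{E}\Big[\Big|\overline{U}^{N,l}_{t+k_1\Delta_l}(Y)-\overline{U}^{l}_{t+k_1\Delta_l}(Y)\Big|^q\Big]^{1/q}\leq\frac{\mathsf{C}}{\sqrt{N}}.$$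
   Context: Model. $(Y_t,X_t)\in\mathbb{R}^{d_y}\times\mathbb{R}^{d_x}$ satisfy $dY_t=CX_t\,dt+R^{1/2}dV_t$, $dX_t=AX_t\,dt+Q^{1/2}dW_t$, where $(V_t,W_t)$ is a $(d_y+d_x)$-dimensional standard Brownian motion, $A\in\mathbb{R}^{d_x\times d_x}$, $C\in\mathbb{R}^{d_y\times d_x}$, $R^{1/2},Q^{1/2}$ are square, symmetric and invertible, $Y_0=0$, and $X_0\sim\mathcal{N}_{d_x}(\mathcal{M}_0,\mathcal{P}_0)$ is independent of $(V,W)$. Put $S=C^{\top}R^{-1}C$ and $\mathrm{Ricc}(G)=AG+GA^{\top}-GSG+Q$. Discretization. For $l\in\mathbb{N}_0$, $\Delta_l=2^{-l}$. Define $m^l_0=\mathcal{M}_0$, $P^l_0=\mathcal{P}_0$ and $m^l_{(k+1)\Delta_l}=m^l_{k\Delta_l}+Am^l_{k\Delta_l}\Delta_l+P^l_{k\Delta_l}C^{\top}R^{-1}([Y_{(k+1)\Delta_l}-Y_{k\Delta_l}]-Cm^l_{k\Delta_l}\Delta_l)$, $P^l_{(k+1)\Delta_l}=P^l_{k\Delta_l}+\mathrm{Ricc}(P^l_{k\Delta_l})\Delta_l+(A-P^l_{k\Delta_l}S)P^l_{k\Delta_l}(A^{\top}-SP^l_{k\Delta_l})\Delta_l^2$. Vanilla ensemble Kalman--Bucy filter (Euler-discretized, $N\ge2$ particles): for $i\in\{1,\dots,N\}$, $k\in\mathbb{N}_0$, $$\xi^i_{(k+1)\Delta_l}=\xi^i_{k\Delta_l}+A\xi^i_{k\Delta_l}\Delta_l+Q^{1/2}[\overline{W}^i_{(k+1)\Delta_l}-\overline{W}^i_{k\Delta_l}]+P^N_{k\Delta_l}C^{\top}R^{-1}\Big([Y_{(k+1)\Delta_l}-Y_{k\Delta_l}]-\big[C\xi^i_{k\Delta_l}\Delta_l+R^{1/2}[\overline{V}^i_{(k+1)\Delta_l}-\overline{V}^i_{k\Delta_l}]\big]\Big),$$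 with $m^N_{k\Delta_l}=\frac1N\sum_i\xi^i_{k\Delta_l}$, $P^N_{k\Delta_l}=\frac1{N-1}\sum_i(\xi^i_{k\Delta_l}-m^N_{k\Delta_l})(\xi^i_{k\Delta_l}-m^N_{k\Delta_l})^{\top}$, where $\xi_0^i$ are i.i.d. $\mathcal{N}_{d_x}(\mathcal{M}_0,\mathcal{P}_0)$, $(\overline{W}^i,\overline{V}^i)$ are independent standard Brownian motions of dimensions $d_x,d_y$, and all of these are independent across $i$ and of $(X,Y)$. Estimators. $\overline{U}^{N,l}_{t+k_1\Delta_l}(Y)=\sum_{k=0}^{t\Delta_l^{-1}+k_1-1}[\langle Cm^N_{k\Delta_l},R^{-1}[Y_{(k+1)\Delta_l}-Y_{k\Delta_l}]\rangle-\frac{\Delta_l}{2}\langle m^N_{k\Delta_l},Sm^N_{k\Delta_l}\rangle]$, and $\overline{U}^{l}_{t+k_1\Delta_l}(Y)$ is the same expression with $m^N_{k\Delta_l}$ replaced by $m^l_{k\Delta_l}$. $\mathbb{E}$ is expectation over all randomness, including $Y$. *)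

(* Defs.v *)
From HB Require Import structures.
From mathcomp Require Import all_boot all_order all_algebra.
From mathcomp Require Import all_classical all_reals all_analysis.

Set Implicit Arguments.
Unset Strict Implicit.
Unset Printing Implicit Defensive.

Import Order.TTheory GRing.Theory Num.Theory.
Import numFieldNormedType.Exports.

Local Open Scope classical_set_scope.
Local Open Scope ring_scope.

Section linear_algebra.
Variable R : realType.

Definition inner (n : nat) (u v : 'cV[R]_n) : R := \sum_(i < n) u i 0 * v i 0.

(* The set of eigenvalues is finite, and nonempty for n > 0 since the matrix is
   symmetric, so the supremum is the largest eigenvalue. *)
Definition log_norm (n : nat) (B : 'M[R]_n) : R :=
  sup [set a : R | eigenvalue (2^-1 *: (B + B^T)) a].

Definition covariance_mx (n : nat) (S : 'M[R]_n) : Prop :=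
  S^T = S /\ forall u : 'cV[R]_n, 0 <= inner u (S *m u).

End linear_algebra.

Section random_vectors.
Context (d : measure_display) (T : measurableType d) (R : realType).
Variable P : probability T R.

Definition random_vector (n : nat) (X : T -> 'cV[R]_n) : Prop :=
  forall i : 'I_n, measurable_fun setT (fun w => X w i 0).

(* N(m, v), parametrized by the variance v >= 0.  The case v = 0 is the Dirac
   mass at m; it is treated apart because normal_prob m 0 is by convention the
   uniform law on [0, 1]. *)
Definition gaussian_law (m v : R) (B : set R) : \bar R :=
  if v == 0 then dirac m B else normal_prob m (Num.sqrt v) B.

(* X ~ N_n(m, S), with S possibly singular: every linear functional <u, X> has
   law N(<u, m>, <u, S u>). *)
Definition gaussian_vector (n : nat) (m : 'cV[R]_n) (S : 'M[R]_n)
    (X : T -> 'cV[R]_n) : Prop :=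
  [/\ covariance_mx S,
      random_vector X
    & forall (u : 'cV[R]_n) (B : set R), measurable B ->
        P ((fun w => inner u (X w)) @^-1` B)
        = gaussian_law (inner u m) (inner u (S *m u)) B].

Definition sigma_rvs (I : Type) (D : set I) (f : I -> T -> R) : set (set T) :=
  <<s \bigcup_(i in D) preimage_set_system setT (f i) measurable >>.

Definition sigma_vector (n : nat) (X : T -> 'cV[R]_n) : set (set T) :=
  sigma_rvs [set: 'I_n] (fun i w => X w i 0).

(* Processes have the time set {t : R | 0 <= t}; values at negative times are
   irrelevant throughout. *)
Definition sigma_process (n : nat) (X : R -> T -> 'cV[R]_n) : set (set T) :=
  sigma_rvs [set p : R * 'I_n | 0 <= p.1] (fun p w => X p.1 w p.2 0).

Definition mutually_independent (I : finType) (G : I -> set (set T)) : Prop :=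
  forall (J : {set I}) (E : I -> set T), (forall i, i \in J -> G i (E i)) ->
    P (\bigcap_(i in [set i | i \in J]) E i) = (\prod_(i in J) P (E i))%E.

Definition ae_continuous_paths (n : nat) (X : R -> T -> 'cV[R]_n) : Prop :=
  {ae P, forall w, {within [set t : R | 0 <= t], continuous (fun t => X t w)}}.

Record brownian_motion (n : nat) (B : R -> T -> 'cV[R]_n) : Prop := {
  bm_random : forall t, 0 <= t -> random_vector (B t);
  bm_start : {ae P, forall w, B 0 w = 0};
  bm_continuous : ae_continuous_paths B;
  bm_gaussian : forall s t, 0 <= s -> s <= t ->
    gaussian_vector 0 ((t - s)%:M) (fun w => B t w - B s w);
  bm_independent : forall (k : nat) (t : nat -> R),
    0 <= t 0%N -> {homo t : i j / (i <= j)%N >-> i <= j} ->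
    mutually_independent
      (fun i : 'I_k => sigma_vector (fun w => B (t i.+1) w - B (t i) w)) }.

End random_vectors.

(* The square roots R^{1/2}, Q^{1/2} are the primitive data; R and Q are their
   squares. *)
Record model (R : realType) (dx dy : nat) := Model {
  mA : 'M[R]_dx;
  mC : 'M[R]_(dy, dx);
  mRhalf : 'M[R]_dy;
  mQhalf : 'M[R]_dx;
  mM0 : 'cV[R]_dx;
  mP0 : 'M[R]_dx;
  mRhalf_sym : mRhalf^T = mRhalf;
  mRhalf_unit : mRhalf \in unitmx;
  mQhalf_sym : mQhalf^T = mQhalf;
  mQhalf_unit : mQhalf \in unitmx }.

Section filter.
Context (R : realType) (dx dy : nat).
Variable M : model R dx dy.

Local Notation A := (mA M).
Local Notation C := (mC M).

Definition mR : 'M[R]_dy := mRhalf M *m mRhalf M.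
Definition mQ : 'M[R]_dx := mQhalf M *m mQhalf M.
Definition mS : 'M[R]_dx := C^T *m invmx mR *m C.

Definition Ricc (G : 'M[R]_dx) : 'M[R]_dx :=
  A *m G + G *m A^T - G *m mS *m G + mQ.

Definition step (l : nat) : R := 2 ^- l.

Definition incr (n : nat) (l : nat) (Z : R -> 'cV[R]_n) (k : nat) : 'cV[R]_n :=
  Z (k.+1%:R * step l) - Z (k%:R * step l).

Fixpoint kb_cov (l k : nat) : 'M[R]_dx :=
  if k is k'.+1 then
    let G := kb_cov l k' in
    G + step l *: Ricc G
      + step l ^+ 2 *: ((A - G *m mS) *m G *m (A^T - mS *m G))
  else mP0 M.

Fixpoint kb_mean (l : nat) (Y : R -> 'cV[R]_dy) (k : nat) : 'cV[R]_dx :=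
  if k is k'.+1 then
    let m := kb_mean l Y k' in
    m + step l *: (A *m m)
      + kb_cov l k' *m C^T *m invmx mR *m (incr l Y k' - step l *: (C *m m))
  else mM0 M.

Definition sample_mean (N : nat) (xi : 'I_N -> 'cV[R]_dx) : 'cV[R]_dx :=
  N%:R^-1 *: \sum_(i < N) xi i.

Definition sample_cov (N : nat) (xi : 'I_N -> 'cV[R]_dx) : 'M[R]_dx :=
  (N%:R - 1)^-1 *: \sum_(i < N)
    (xi i - sample_mean xi) *m (xi i - sample_mean xi)^T.

Fixpoint enkf (N l : nat) (Y : R -> 'cV[R]_dy) (xi0 : 'I_N -> 'cV[R]_dx)
    (Wb : 'I_N -> R -> 'cV[R]_dx) (Vb : 'I_N -> R -> 'cV[R]_dy) (k : nat)
    : 'I_N -> 'cV[R]_dx :=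
  if k is k'.+1 then
    let xi := enkf l Y xi0 Wb Vb k' in
    fun i => xi i + step l *: (A *m xi i) + mQhalf M *m incr l (Wb i) k'
      + sample_cov xi *m C^T *m invmx mR
          *m (incr l Y k'
              - (step l *: (C *m xi i) + mRhalf M *m incr l (Vb i) k'))
  else xi0.

Definition log_estimate (l : nat) (Y : R -> 'cV[R]_dy) (m : nat -> 'cV[R]_dx)
    (n : nat) : R :=
  \sum_(k < n) (inner (C *m m k) (invmx mR *m incr l Y k)
                - step l / 2 * inner (m k) (mS *m m k)).

(* The time t + k1 * step l is grid point number t * 2 ^ l + k1. *)
Definition U_limit (l t k1 : nat) (Y : R -> 'cV[R]_dy) : R :=
  log_estimate l Y (kb_mean l Y) (t * 2 ^ l + k1).

Definition U_enkf (N l t k1 : nat) (Y : R -> 'cV[R]_dy)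
    (xi0 : 'I_N -> 'cV[R]_dx) (Wb : 'I_N -> R -> 'cV[R]_dx)
    (Vb : 'I_N -> R -> 'cV[R]_dy) : R :=
  log_estimate l Y (fun k => sample_mean (enkf l Y xi0 Wb Vb k))
    (t * 2 ^ l + k1).

Context (d : measure_display) (T : measurableType d).
Variable P : probability T R.

Definition path_integral (n : nat) (F : R -> 'cV[R]_n) (t : R) : 'cV[R]_n :=
  \col_i (\int[lebesgue_measure]_(s in `[0, t]) F s i 0).

(* The noise coefficients are constant, so the stochastic differential equations
   are the almost sure pathwise integral equations below. *)
Record signal_observation (V : R -> T -> 'cV[R]_dy) (W : R -> T -> 'cV[R]_dx)
    (Y : R -> T -> 'cV[R]_dy) (X : R -> T -> 'cV[R]_dx) : Prop := {
  so_noise : brownian_motion P (fun t w => col_mx (V t w) (W t w));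
  so_X0_law : gaussian_vector P (mM0 M) (mP0 M) (X 0);
  so_X0_independent : mutually_independent P
    (fun b : bool => if b then sigma_vector (X 0)
                     else sigma_process (fun t w => col_mx (V t w) (W t w)));
  so_X_random : forall t, 0 <= t -> random_vector (X t);
  so_Y_random : forall t, 0 <= t -> random_vector (Y t);
  so_X_continuous : ae_continuous_paths P X;
  so_Y0 : {ae P, forall w, Y 0 w = 0};
  so_X_eq : {ae P, forall w, forall t, 0 <= t ->
    X t w = X 0 w + path_integral (fun s => A *m X s w) t
            + mQhalf M *m W t w};
  so_Y_eq : {ae P, forall w, forall t, 0 <= t ->
    Y t w = Y 0 w + path_integral (fun s => C *m X s w) t
            + mRhalf M *m V t w} }.

Record ensemble_noise (N : nat) (Y : R -> T -> 'cV[R]_dy)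
    (X : R -> T -> 'cV[R]_dx) (xi0 : 'I_N -> T -> 'cV[R]_dx)
    (Wb : 'I_N -> R -> T -> 'cV[R]_dx) (Vb : 'I_N -> R -> T -> 'cV[R]_dy)
    : Prop := {
  en_xi0_law : forall i, gaussian_vector P (mM0 M) (mP0 M) (xi0 i);
  en_Wb : forall i, brownian_motion P (Wb i);
  en_Vb : forall i, brownian_motion P (Vb i);
  en_independent : mutually_independent P
    (fun j : unit + ('I_N + ('I_N + 'I_N)) =>
       match j with
       | inl _ => sigma_process (fun t w => col_mx (Y t w) (X t w))
       | inr (inl i) => sigma_vector (xi0 i)
       | inr (inr (inl i)) => sigma_process (Wb i)
       | inr (inr (inr i)) => sigma_process (Vb i)
       end) }.

End filter.

(* Main.v *)
From HB Require Import structures.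
Require Import Defs.
From mathcomp Require Import all_boot all_order all_algebra.
From mathcomp Require Import all_classical all_reals all_analysis.
From mathcomp Require Import measurable_realfun.
From mathcomp Require Import ring lra.

Import Order.TTheory GRing.Theory Num.Theory.
Import numFieldNormedType.Exports.

Set Implicit Arguments.
Unset Strict Implicit.
Unset Printing Implicit Defensive.

Local Open Scope classical_set_scope.
Local Open Scope ring_scope.

(** The number of grid steps is fixed, so only finitely many Gaussian noise
    vectors per particle enter, and the estimate is a law of large numbers
    pushed through a polynomial recursion.

    Consider families of random variables indexed by all ensembles of all sizes
    N.  A family is tame when every absolute moment is bounded uniformly over
    the family; two tame families are close when sqrt N times their difference
    is tame.  Since |x y| ^ p <= |x| ^ 2p + |y| ^ 2p, tame families form an
    algebra, and closeness is a congruence of that algebra ([closeD], [closeM]):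
    in x x' - y y' = (x - y) x' + y (x' - y') each term is a product of a tame
    factor and of one that is tame after scaling by sqrt N.  The theorem says
    that the two log-likelihood estimators are close ([log_estimate_close]).

    One filter step sends each particle xi to
      B xi + Q^{1/2} dW - K R^{1/2} dV + K dY,
    where B and K are polynomials in the current sample covariance and K dY is
    shared by all particles.  Sample covariances are bilinear and blind to
    shared translations, so the next sample covariance is a polynomial in the
    current one and in the sample cross-covariances of xi, dW and dV.  By
    induction ([covariance_close]) the sample covariance stays close to the
    deterministic covariance and the cross-covariances of xi with future noise
    stay close to 0; inserting these limits gives exactly the deterministic
    Riccati step ([kb_cov_step]).  The sample mean follows ([mean_close_kb]),
    and with it the estimator.

    Three probabilistic facts start the induction.
    - Averages over independent particles are close to their mean ([lln]),
      because centred independent sums satisfy E S_n ^ 2p <= C n ^ p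
      ([sum_moment_bound]).  The required independence of a whole particle from
      the preceding ones is obtained from Dynkin's theorem ([group_indep]).
    - Gaussian variables have bounded moments and the expected mean and
      covariance ([gaussian_abs_moment], [gaussian_vector_cov]).
    - The observation has moments of all orders ([observation_tame1]): a discrete
      Gronwall inequality on fine grids bounds it by Riemann averages of the
      Brownian path, whose moments are under control, and Fatou's lemma passes
      to the limit. *)

(** * Families with uniformly bounded moments *)

Section power_inequalities.
Context {R : realType}.
Implicit Types x y : R.

Lemma ler_normD_expn x y p :
  `|x + y| ^+ p <= 2 ^+ p * (`|x| ^+ p + `|y| ^+ p).
Proof.
have [xy|yx] := leP `|x| `|y|.
  apply: (@le_trans _ _ ((2 * `|y|) ^+ p)).
    rewrite lerXn2r ?nnegrE ?mulr_ge0// (le_trans (ler_normD _ _))//; lra.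
  by rewrite exprMn ler_wpM2l ?exprn_ge0// lerDr exprn_ge0.
apply: (@le_trans _ _ ((2 * `|x|) ^+ p)).
  rewrite lerXn2r ?nnegrE ?mulr_ge0// (le_trans (ler_normD _ _))//; lra.
by rewrite exprMn ler_wpM2l ?exprn_ge0// lerDl exprn_ge0.
Qed.

Lemma ler_normM_expn x y p :
  `|x * y| ^+ p <= `|x| ^+ (2 * p) + `|y| ^+ (2 * p).
Proof.
rewrite normrM exprMn mulnC !exprM.
have := sqr_ge0 (`|x| ^+ p - `|y| ^+ p).
have : 0 <= `|x| ^+ p * `|y| ^+ p by rewrite mulr_ge0 ?exprn_ge0.
nra.
Qed.

Lemma ler_expn_1D x p r : 0 <= x -> (p <= r)%N -> x ^+ p <= 1 + x ^+ r.
Proof.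
move=> x0 pr; have [x1|x1] := leP x 1.
  by rewrite (le_trans (exprn_ile1 _ x0 x1))// lerDl exprn_ge0.
by rewrite (le_trans (ler_weXn2l _ pr)) ?lerDr ?ler01// ltW.
Qed.

End power_inequalities.

Section tame.
Context (d : measure_display) (T : measurableType d) (R : realType).
Variable P : probability T R.
Implicit Types (f g : T -> R).

Definition abs_moment (p : nat) (f : T -> R) : \bar R :=
  (\int[P]_w (`|f w| ^+ p)%:E)%E.

Definition tame (I : Type) (X : I -> T -> R) : Prop :=
  (forall i, measurable_fun setT (X i)) /\
  forall p, exists C : R, forall i, (abs_moment p (X i) <= C%:E)%E.

Lemma measurable_abs_expn p f : measurable_fun setT f ->
  measurable_fun setT (fun w => `|f w| ^+ p).
Proof. by move=> mf; apply: measurable_funX; exact: measurableT_comp. Qed.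

Lemma le_abs_moment p f g : measurable_fun setT f -> measurable_fun setT g ->
  (forall w, `|f w| <= `|g w|) -> (abs_moment p f <= abs_moment p g)%E.
Proof.
move=> mf mg fg; apply: ge0_le_integral => //=; do ?[exact/measurable_EFinP/measurable_abs_expn].
by move=> w _; rewrite lee_fin lerXn2r ?nnegrE.
Qed.

Lemma integral_le_bound (h : T -> R) (c : R) (a b : T -> R) (A B : R) :
  measurable_fun setT h -> measurable_fun setT a -> measurable_fun setT b ->
  (forall w, 0 <= h w) -> (forall w, 0 <= a w) -> (forall w, 0 <= b w) ->
  0 <= c -> (forall w, h w <= c * (a w + b w)) ->
  (\int[P]_w (a w)%:E <= A%:E)%E -> (\int[P]_w (b w)%:E <= B%:E)%E ->
  (\int[P]_w (h w)%:E <= (c * (A + B))%:E)%E.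
Proof.
move=> mh ma mb h0 a0 b0 c0 hab aA bB.
apply: (@le_trans _ _ (\int[P]_w (c%:E * ((a w)%:E + (b w)%:E)))%E).
  apply: ge0_le_integral => //=.
  - by move=> w _; rewrite lee_fin.
  - exact/measurable_EFinP.
  - apply: (@eq_measurable_fun _ _ _ _ _ (EFin \o (fun w => c * (a w + b w)))) => //.
    by apply/measurable_EFinP/measurable_funM => //; exact: measurable_funD.
  - by move=> w _; rewrite lee_fin.
rewrite ge0_integralZl//=; last 2 first.
- by apply: emeasurable_funD; exact/measurable_EFinP.
- by move=> w _; rewrite adde_ge0 ?lee_fin.
rewrite ge0_integralD//=; last 4 first.
- by move=> w _; rewrite lee_fin.
- exact/measurable_EFinP.
- by move=> w _; rewrite lee_fin.
- exact/measurable_EFinP.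
by rewrite EFinM EFinD lee_wpmul2l ?lee_fin// leeD.
Qed.

Lemma tame_measurable I (X : I -> T -> R) i : tame X -> measurable_fun setT (X i).
Proof. by case. Qed.

Lemma tame_le I (X Y : I -> T -> R) : (forall i, measurable_fun setT (X i)) ->
  tame Y -> (forall i w, `|X i w| <= `|Y i w|) -> tame X.
Proof.
move=> mX [mY tY] XY; split=> // p; have [C YC] := tY p.
by exists C => i; rewrite (le_trans _ (YC i))// le_abs_moment.
Qed.

Lemma tame_reindex I J (g : J -> I) (X : I -> T -> R) :
  tame X -> tame (fun j => X (g j)).
Proof.
by case=> mX tX; split=> // p; have [C XC] := tX p; exists C.
Qed.

Lemma tame_bounded I (c : I -> R) (K : R) :
  (forall i, `|c i| <= K) -> tame (fun i (_ : T) => c i).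
Proof.
move=> cK; split=> [i|p]; first exact: measurable_cst.
exists (K ^+ p) => i; rewrite /abs_moment integral_cst//= probability_setT mule1.
by rewrite lee_fin lerXn2r ?nnegrE// (le_trans _ (cK i)).
Qed.

Lemma tame_cst I (c : R) : tame (fun (_ : I) (_ : T) => c).
Proof. exact: (@tame_bounded _ _ `|c|). Qed.

Lemma tameD I (X Y : I -> T -> R) : tame X -> tame Y ->
  tame (fun i w => X i w + Y i w).
Proof.
move=> [mX tX] [mY tY]; split=> [i|p]; first exact: measurable_funD.
have [A XA] := tX p; have [B YB] := tY p; exists (2 ^+ p * (A + B)) => i.
apply: (integral_le_bound _ _ _ _ _ _ _ _ (XA i) (YB i)) => //.
- exact/measurable_abs_expn/measurable_funD.
- exact/measurable_abs_expn.
- exact/measurable_abs_expn.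
- by move=> w; rewrite ler_normD_expn.
Qed.

Lemma tameM I (X Y : I -> T -> R) : tame X -> tame Y ->
  tame (fun i w => X i w * Y i w).
Proof.
move=> [mX tX] [mY tY]; split=> [i|p]; first exact: measurable_funM.
have [A XA] := tX (2 * p)%N; have [B YB] := tY (2 * p)%N.
exists (1 * (A + B)) => i.
apply: (integral_le_bound _ _ _ _ _ _ _ _ (XA i) (YB i)) => //.
- exact/measurable_abs_expn/measurable_funM.
- exact/measurable_abs_expn.
- exact/measurable_abs_expn.
- by move=> w; rewrite mul1r ler_normM_expn.
Qed.

Lemma tameZ I (c : R) (X : I -> T -> R) : tame X -> tame (fun i w => c * X i w).
Proof. by move=> tX; apply: tameM => //; exact: tame_cst. Qed.

Lemma tameN I (X : I -> T -> R) : tame X -> tame (fun i w => - X i w).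
Proof.
move=> tX; apply: (@tame_le _ _ X) => // [i|i w]; last by rewrite normrN.
by apply: measurableT_comp => //; exact: tame_measurable tX.
Qed.

Lemma tameB I (X Y : I -> T -> R) : tame X -> tame Y ->
  tame (fun i w => X i w - Y i w).
Proof. by move=> tX tY; apply: tameD => //; exact: tameN. Qed.

(** The sum has a fixed number of terms; averages of a varying number of terms
    are treated in [tame_average]. *)
Lemma tame_sum I J (s : seq J) (X : J -> I -> T -> R) :
  (forall j, tame (X j)) -> tame (fun i w => \sum_(j <- s) X j i w).
Proof.
move=> tX; elim: s => [|j s IH].
  by under eq_fun do under eq_fun do rewrite big_nil; exact: tame_cst.
by under eq_fun do under eq_fun do rewrite big_cons; exact: tameD.
Qed.

Lemma tameX I (X : I -> T -> R) n : tame X -> tame (fun i w => X i w ^+ n).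
Proof.
move=> tX; elim: n => [|n IH].
  by under eq_fun do under eq_fun do rewrite expr0; exact: tame_cst.
by under eq_fun do under eq_fun do rewrite exprS; exact: tameM.
Qed.

Lemma tame_norm I (X : I -> T -> R) : tame X -> tame (fun i w => `|X i w|).
Proof.
move=> tX; apply: (@tame_le _ _ X) => // [i|i w]; last by rewrite normr_id.
by apply: measurableT_comp => //; exact: tame_measurable tX.
Qed.

Lemma tame_integrable I (X : I -> T -> R) i : tame X ->
  P.-integrable setT (EFin \o X i).
Proof.
move=> [mX tX]; apply/integrableP; split; first exact/measurable_EFinP.
have [C /(_ i) XC] := tX 1%N; apply: le_lt_trans (ltry C).
by under eq_integral do rewrite /= -(expr1 `|X i _|).
Qed.

End tame.

(** * Independence and expectations of products *)

Section independence.
Context (d : measure_display) (T : measurableType d) (R : realType).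
Variable P : probability T R.

(** [G] is a generating system: measurability is with respect to <<s G>>, the
    sigma-algebra carried by [g_sigma_algebraType G]. *)
Definition sub_measurable (G : set (set T)) (f : T -> R) : Prop :=
  @measurable_fun _ _ (g_sigma_algebraType G) R setT f.

Lemma sub_measurableP (G : set (set T)) (f : T -> R) :
  sub_measurable G f <-> forall B, measurable B -> <<s G >> (f @^-1` B).
Proof.
split=> [mf B mB|mf _ B mB].
  by have := mf (@measurableT _ (g_sigma_algebraType G)) B mB; rewrite setTI.
by rewrite setTI; exact: mf.
Qed.

Lemma sub_measurable_trans (G H : set (set T)) (f : T -> R) :
  G `<=` <<s H >> -> sub_measurable G f -> sub_measurable H f.
Proof.
move=> GH /sub_measurableP mf; apply/sub_measurableP => B mB.
have /smallest_sub : sigma_algebra setT <<s H >> by exact: smallest_sigma_algebra.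
by move=> /(_ _ GH); apply; exact: mf.
Qed.

Definition indep_rv (f g : T -> R) : Prop :=
  forall A B, measurable A -> measurable B ->
    P (f @^-1` A `&` g @^-1` B) = (P (f @^-1` A) * P (g @^-1` B))%E.

Lemma indep_rv_comp (f g h k : T -> R) (u v : R -> R) :
  measurable_fun setT u -> measurable_fun setT v ->
  h = u \o f -> k = v \o g -> indep_rv f g -> indep_rv h k.
Proof.
move=> mu mv -> -> fg A B mA mB.
have mA' : measurable (u @^-1` A) by rewrite -[X in measurable X]setTI; exact: mu.
have mB' : measurable (v @^-1` B) by rewrite -[X in measurable X]setTI; exact: mv.
exact: fg mA' mB'.
Qed.

(** The joint law of independent variables is the product of their laws, so that
    the identity is Fubini's theorem for the product of the two coordinates. *)
Lemma indep_rvM (f g : T -> R) :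
  measurable_fun setT f -> measurable_fun setT g -> indep_rv f g ->
  P.-integrable setT (EFin \o f) -> P.-integrable setT (EFin \o g) ->
  P.-integrable setT (EFin \o (f \* g)) ->
  (\int[P]_w (f w * g w)%:E =
   (\int[P]_w (f w)%:E) * (\int[P]_w (g w)%:E))%E.
Proof.
move=> mf mg fg intf intg intfg.
pose f' : {mfun T >-> R} := HB.pack f (isMeasurableFun.Build _ _ _ _ f mf).
pose g' : {mfun T >-> R} := HB.pack g (isMeasurableFun.Build _ _ _ _ g mg).
have mh : measurable_fun setT (fun w => (f w, g w)) by exact/measurable_fun_pairP.
pose h' : {mfun T >-> (R * R)%type} :=
  HB.pack (fun w => (f w, g w)) (isMeasurableFun.Build _ _ _ _ _ mh).
pose mF := distribution P f'; pose mG := distribution P g'.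
pose mH := distribution P h'.
have HE A : measurable A -> (mF \x mG)%E A = mH A.
  by apply: product_measure_unique => B C mB mC; rewrite -fg.
have mfst : measurable_fun setT (fun z : R * R => z.1) by exact: measurable_fst.
have msnd : measurable_fun setT (fun z : R * R => z.2) by exact: measurable_snd.
have mpr : measurable_fun setT (fun z : R * R => (z.1 * z.2)%:E).
  by apply/measurable_EFinP/measurable_funM.
have Eh : (\int[P]_w (f w * g w)%:E = \int[mH]_z (z.1 * z.2)%:E)%E.
  by rewrite integral_distribution.
have Ef : (\int[P]_w (f w)%:E = \int[mF]_x x%:E)%E.
  by rewrite integral_distribution.
have Eg : (\int[P]_w (g w)%:E = \int[mG]_x x%:E)%E.
  by rewrite integral_distribution.
have iH : (mF \x mG)%E.-integrable setT (fun z : R * R => (z.1 * z.2)%:E).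
  apply/integrableP; split => //.
  rewrite (eq_measure_integral mH); last by move=> A mA _; exact: HE.
  have /integrableP[_] : mH.-integrable setT (fun z : R * R => (z.1 * z.2)%:E).
    by apply: integrable_pushforward.
  by [].
have mE : measurable_fun setT (fun x : R => x%:E) by exact/measurable_EFinP.
have iF : mF.-integrable setT (fun x : R => x%:E).
  exact: (integrable_pushforward mf mE).
have iG : mG.-integrable setT (fun x : R => x%:E).
  exact: (integrable_pushforward mg mE).
rewrite Eh Ef Eg.
transitivity (\int[(mF \x mG)%E]_z (z.1 * z.2)%:E)%E.
  by apply: eq_measure_integral => A mA _; exact/esym/HE.
rewrite -integral12_prod_meas1//=.
have Gfin : (\int[mG]_x x%:E)%E \is a fin_num.
  by apply: integrable_fin_num.
transitivity (\int[mF]_x (x%:E * \int[mG]_y y%:E))%E.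
  by apply: eq_integral => x _; rewrite /fubini_F/=; under eq_integral do rewrite EFinM;
    rewrite integralZl.
by rewrite -(fineK Gfin) integralZr.
Qed.

End independence.

(** * Grouping independent sigma-algebras *)

Section grouping.
Context (d : measure_display) (T : measurableType d) (R : realType).
Variable P : probability T R.
Context (K : finType) (G : K -> set (set T)).
Hypothesis G_measurable : forall k, G k `<=` measurable.
Hypothesis G_setI : forall k, setI_closed (G k).
Hypothesis G_setT : forall k, G k setT.
Hypothesis G_indep : mutually_independent P G.

Definition union_system (J : {set K}) : set (set T) :=
  \bigcup_(k in [set k | k \in J]) G k.

(** Intersections of one event per label form a pi-system generating the same
   sigma-algebra as the union; labels outside J contribute nothing. *)
Let cylinders (J : {set K}) : set (set T) :=
  [set A | exists2 E : K -> set T, (forall k, G k (E k)) &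
                                   A = \bigcap_(k in [set k | k \in J]) E k].

Let cylinders_setI J : setI_closed (cylinders J).
Proof.
move=> _ _ [E GE ->] [F GF ->]; exists (fun k => E k `&` F k) => [k|].
  exact: G_setI.
by rewrite bigcapI.
Qed.

Let cylinders_measurable J : cylinders J `<=` measurable.
Proof.
move=> _ [E GE ->]; apply: fin_bigcap_measurable => [|k _].
  exact: finite_finset.
exact: G_measurable.
Qed.

Let union_cylinders J : union_system J `<=` cylinders J.
Proof.
move=> A [k /= kJ GA]; exists (fun j => if j == k then A else setT) => [j|].
  by case: eqP => [->|].
apply/seteqP; split=> [w Aw j /= jJ|w /(_ k kJ)]; last by rewrite eqxx.
by case: eqP.
Qed.

Let cylinders_setT J : cylinders J setT.
Proof. by exists (fun=> setT) => //; rewrite bigcapT. Qed.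

Let cylinders_indep (J1 J2 : {set K}) A B :
  (forall k, k \in J1 -> k \notin J2) ->
  cylinders J1 A -> cylinders J2 B -> P (A `&` B) = (P A * P B)%E.
Proof.
move=> J12 [E GE ->] [F GF ->].
pose H k := if k \in J1 then E k else F k.
have GH k : G k (H k) by rewrite /H; case: ifP.
have HE k : k \in J1 -> H k = E k by rewrite /H => ->.
have HF k : k \in J2 -> H k = F k.
  by move=> kJ2; rewrite /H; case: ifPn => // /J12; rewrite kJ2.
have -> : \bigcap_(k in [set k | k \in J1]) E k `&`
          \bigcap_(k in [set k | k \in J2]) F k =
          \bigcap_(k in [set k | k \in J1 :|: J2]) H k.
  apply/seteqP; split=> [w [hE hF] k /=|w h].
    rewrite inE => /orP[kJ|kJ]; first by rewrite HE//; exact: hE.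
    by rewrite HF//; exact: hF.
  split=> k /= kJ.
    by rewrite -HE//; apply: h; rewrite /= inE kJ.
  by rewrite -HF//; apply: h; rewrite /= inE kJ orbT.
rewrite !G_indep//.
have dJ : fintype.disjoint (mem J1) (mem J2).
  by rewrite disjoint_subset; apply/fintype.subsetP => k /J12.
rewrite (eq_bigl [predU J1 & J2]); last by move=> k; rewrite !inE.
rewrite bigU//=.
by congr (_ * _)%E; apply: eq_bigr => k kJ; [rewrite (HE k kJ)|rewrite (HF k kJ)].
Qed.

(** For a fixed B, the measures A |-> P (A `&` B) and A |-> P A * P B agree on the
   pi-system C, hence on the sigma-algebra it generates. *)
Let extend_indep (C D : set (set T)) :
  C `<=` measurable -> setI_closed C -> C setT -> D `<=` measurable ->
  (forall A B, C A -> D B -> P (A `&` B) = (P A * P B)%E) ->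
  forall A B, <<s C >> A -> D B -> P (A `&` B) = (P A * P B)%E.
Proof.
move=> mC CI CT mD CD A B CA DB.
have mB : measurable B by exact: mD.
pose r : {nonneg R} := NngNum (fine_ge0 (measure_ge0 P B)).
have PB : P B = (r%:num)%:E by rewrite /= fineK// fin_num_measure.
have mrE X : mrestr P mB X = P (X `&` B) by [].
have mscE X : mscale r P X = (P X * P B)%E by rewrite PB muleC.
rewrite -mrE -mscE.
apply: (@g_sigma_algebra_measure_unique _ _ _ C mC (fun=> setT)) => //.
- by rewrite bigcup_const.
- by move=> X CX; exact: etrans (mrE X) (etrans (CD _ _ CX DB) (esym (mscE X))).
- move=> _; change (P (setT `&` B) < +oo)%E; rewrite setTI.
  exact: le_lt_trans (probability_le1 P mB) (ltry _).
Qed.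

(** Mutual independence of single labels passes to disjoint groups of labels: the
    product rule holds on cylinders, and is extended in each argument in turn. *)
Lemma group_indep (J1 J2 : {set K}) A B :
  (forall k, k \in J1 -> k \notin J2) ->
  <<s union_system J1 >> A -> <<s union_system J2 >> B ->
  P (A `&` B) = (P A * P B)%E.
Proof.
move=> J12.
have sub J X : <<s union_system J >> X -> <<s cylinders J >> X.
  apply: smallest_sub; first exact: smallest_sigma_algebra.
  by move=> Y /union_cylinders; exact: sub_gen_smallest.
have smeas J : <<s cylinders J >> `<=` measurable.
  apply: smallest_sub; last exact: cylinders_measurable.
  exact: sigma_algebra_measurable.
move=> /sub A1 /sub B2.
have ext A' B' : cylinders J1 A' -> <<s cylinders J2 >> B' ->
    P (A' `&` B') = (P A' * P B')%E.
  move=> hA hB; rewrite setIC muleC.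
  apply: (extend_indep (@cylinders_measurable J2) (@cylinders_setI J2)
    (cylinders_setT J2) (@cylinders_measurable J1) _ hB hA) => X Y hX hY.
  by rewrite setIC muleC; exact: cylinders_indep hY hX.
exact: (extend_indep (@cylinders_measurable J1) (@cylinders_setI J1)
  (cylinders_setT J1) (@smeas J2) ext A1 B2).
Qed.

Lemma group_indep_rv (J1 J2 : {set K}) (f g : T -> R) :
  (forall k, k \in J1 -> k \notin J2) ->
  sub_measurable (union_system J1) f -> sub_measurable (union_system J2) g ->
  indep_rv P f g.
Proof.
move=> J12 /sub_measurableP mf /sub_measurableP mg A B mA mB.
by apply: group_indep J12 _ _; [exact: mf|exact: mg].
Qed.

End grouping.

(** * Moments of sums of independent centred variables *)

Section expectations.
Context (d : measure_display) (T : measurableType d) (R : realType).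
Variable P : probability T R.
Implicit Types f g : T -> R.

(** One random variable is a family over [unit], so the closure properties of
    tame families apply to it. *)
Definition tame1 f := tame P (fun _ : unit => f).

(** Expectations as real numbers, so that ring and order tactics apply; tame variables
    are integrable, hence no default value is involved ([ExE]). *)
Definition Ex f : R := \int[P]_w f w.

Lemma tame1_of I (X : I -> T -> R) i : tame P X -> tame1 (X i).
Proof. exact: (@tame_reindex _ _ _ _ I unit (fun=> i)). Qed.

Lemma tame1_integrable f : tame1 f -> P.-integrable setT (EFin \o f).
Proof. exact: (@tame_integrable _ _ _ _ _ _ tt). Qed.

Lemma tame1_measurable f : tame1 f -> measurable_fun setT f.
Proof. by case=> /(_ tt). Qed.

Lemma tame1D f g : tame1 f -> tame1 g -> tame1 (fun w => f w + g w).
Proof. exact: tameD. Qed.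
Lemma tame1M f g : tame1 f -> tame1 g -> tame1 (fun w => f w * g w).
Proof. exact: tameM. Qed.
Lemma tame1Z c f : tame1 f -> tame1 (fun w => c * f w).
Proof. exact: tameZ. Qed.
Lemma tame1_cst c : tame1 (fun=> c).
Proof. exact: tame_cst. Qed.
Lemma tame1X f n : tame1 f -> tame1 (fun w => f w ^+ n).
Proof. exact: tameX. Qed.
Lemma tame1_norm f : tame1 f -> tame1 (fun w => `|f w|).
Proof. exact: tame_norm. Qed.
Lemma tame1_sum J (s : seq J) (X : J -> T -> R) :
  (forall j, tame1 (X j)) -> tame1 (fun w => \sum_(j <- s) X j w).
Proof. by move=> tX; apply: (tame_sum s (X := fun j _ => X j)). Qed.

Lemma ExE f : tame1 f -> (\int[P]_w (f w)%:E)%E = (Ex f)%:E.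
Proof.
move=> tf; rewrite fineK//; apply: integrable_fin_num => //.
exact: tame1_integrable.
Qed.

Lemma ExD f g : tame1 f -> tame1 g -> Ex (fun w => f w + g w) = Ex f + Ex g.
Proof. by move=> /tame1_integrable ? /tame1_integrable ?; exact: RintegralD. Qed.

Lemma ExZ c f : tame1 f -> Ex (fun w => c * f w) = c * Ex f.
Proof. by move=> /tame1_integrable ?; exact: RintegralZl. Qed.

Lemma eq_Ex f g : f =1 g -> Ex f = Ex g.
Proof. by move=> /funext ->. Qed.

Lemma Ex_cst c : Ex (fun=> c) = c.
Proof. by rewrite /Ex Rintegral_cst//= probability_setT mulr1. Qed.

Lemma Ex_le f g : tame1 f -> tame1 g -> (forall w, f w <= g w) -> Ex f <= Ex g.
Proof.
by move=> /tame1_integrable ? /tame1_integrable ? fg; apply: le_Rintegral.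
Qed.

Lemma ExM f g : tame1 f -> tame1 g -> indep_rv P f g ->
  Ex (fun w => f w * g w) = Ex f * Ex g.
Proof.
move=> tf tg fg; have tfg := tame1M tf tg; apply: EFin_inj.
rewrite EFinM -!ExE//; apply: indep_rvM => //;
  by [exact: tame1_measurable|exact: tame1_integrable].
Qed.

Lemma tame_Ex I (X : I -> T -> R) p : tame P X ->
  exists C, forall i, Ex (fun w => `|X i w| ^+ p) <= C.
Proof.
move=> tX; have [C XC] := tX.2 p; exists C => i; rewrite -lee_fin -ExE ?XC//.
exact/tame1X/tame1_norm/tame1_of.
Qed.

Lemma tame_of_even_moments I (X : I -> T -> R) : (forall i, tame1 (X i)) ->
  (forall p, exists C, forall i, Ex (fun w => X i w ^+ p.*2) <= C) -> tame P X.
Proof.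
move=> tX XC; split=> [i|p]; first exact: tame1_measurable.
have [C hC] := XC p; exists (1 + C) => i.
rewrite /abs_moment ExE ?lee_fin; last exact/tame1X/tame1_norm.
apply: (@le_trans _ _ (Ex (fun w => 1 + X i w ^+ p.*2))).
  apply: Ex_le => [||w].
  - exact/tame1X/tame1_norm.
  - by apply: tame1D; [exact: tame1_cst|exact: tame1X].
  - have -> : X i w ^+ p.*2 = `|X i w| ^+ p.*2.
      by rewrite -mul2n !exprM real_normK ?num_real.
    by apply: ler_expn_1D => //; rewrite -addnn leq_addr.
by rewrite ExD ?Ex_cst ?lerD2l//; [exact: tame1_cst|exact: tame1X].
Qed.

End expectations.

Section moments_of_sums.
Context (d : measure_display) (T : measurableType d) (R : realType).
Variable P : probability T R.
Local Notation Ex := (Ex P).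

Lemma expn_double_ge0 (x : R) p : 0 <= x ^+ p.*2.
Proof. by rewrite -mul2n exprM exprn_ge0 ?sqr_ge0. Qed.

Lemma norm_expn_double (x : R) p : `|x| ^+ p.*2 = x ^+ p.*2.
Proof. by rewrite -mul2n !exprM real_normK ?num_real. Qed.

(** The two leading terms of the binomial formula are kept exact; in the others the
    exponent of s is at most 2p, so each is bounded by the even powers at hand. *)
Lemma binomial_remainder p : exists2 B : R, 0 <= B & forall s z : R,
  (s + z) ^+ p.+1.*2 <= s ^+ p.+1.*2 + p.+1.*2%:R * (s ^+ p.*2.+1 * z) +
                        B * ((1 + s ^+ p.*2) * (1 + z ^+ p.+1.*2)).
Proof.
exists (\sum_(i < p.*2.+1) 'C(p.*2.+2, i.+2)%:R) => [|s z].
  by apply: sumr_ge0 => i _; rewrite ler0n.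
rewrite doubleS exprDn 2!big_ord_recl /= /bump /= subn0 expr0 mulr1 bin0 mulr1n.
rewrite subSS subn0 expr1 bin1 -[X in _ <= X]addrA lerD2l.
rewrite -[_ *+ _]mulr_natl lerD2l mulr_suml; apply: ler_sum => i _.
rewrite !add1n -[_ *+ _]mulr_natl ler_wpM2l ?ler0n//.
rewrite (le_trans (ler_norm _))// normrM !normrX ler_pM ?exprn_ge0//.
  rewrite -norm_expn_double ler_expn_1D//.
  by rewrite !subSS leq_subr.
by rewrite -doubleS -norm_expn_double ler_expn_1D// doubleS !ltnS -ltnS.
Qed.

(** Double induction, on p and on the number of terms.  When a term z is added to a
    sum S, the linear term E (S ^ (2p+1) z) vanishes by independence, and the
    remainder is at most a constant times 1 + E S ^ 2p = O(n ^ p) by the induction on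
    p.  Adding up n such increments gives O(n ^ (p+1)). *)
Lemma sum_moment_bound (M : nat -> R) p : exists2 C : R, 0 <= C &
  forall (n : nat) (z : nat -> T -> R),
    (forall j, tame1 P (z j)) ->
    (forall j r, Ex (fun w => z j w ^+ r.*2) <= M r) ->
    (forall j, (j < n)%N -> Ex (z j) = 0) ->
    (forall k, (k < n)%N -> indep_rv P (fun w => \sum_(j < k) z j w) (z k)) ->
    Ex (fun w => (\sum_(j < n) z j w) ^+ p.*2) <= C * n%:R ^+ p.
Proof.
elim: p => [|p [C C0 IH]].
  exists 1 => // n z _ _ _ _.
  by rewrite (@eq_Ex _ _ _ _ _ (fun=> 1)) ?Ex_cst ?expr0 ?mulr1.
have [B B0 HB] := binomial_remainder p.
pose D := B * ((1 + C) * (1 + `|M p.+1|)).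
exists D => [|n z tz mz]; first by rewrite !mulr_ge0 ?addr_ge0.
have tS k : tame1 P (fun w => \sum_(j < k) z j w).
  by apply: (@tame1_sum _ _ _ P _ _ (fun (j : 'I_k) => z j)).
elim: n => [|n IHn] z0 zi.
  rewrite (@eq_Ex _ _ _ _ _ (fun=> 0)) ?Ex_cst ?expr0n ?mulr0// => w.
  by rewrite big_ord0 expr0n.
set S := fun w => \sum_(j < n) z j w.
have tS' : tame1 P S by exact: tS.
have Si : indep_rv P S (z n) by exact: zi.
have {}IHn : Ex (fun w => S w ^+ p.+1.*2) <= D * n%:R ^+ p.+1.
  by apply: IHn => k kn; [apply: z0|apply: zi]; exact: ltnW.
have {}IH : Ex (fun w => S w ^+ p.*2) <= C * n%:R ^+ p.
  by apply: IH => // k kn; [apply: z0|apply: zi]; exact: ltnW.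
have iX u v : indep_rv P (fun w => S w ^+ u) (fun w => z n w ^+ v).
  exact: (indep_rv_comp (u := fun x => x ^+ u) (v := fun x => x ^+ v) _ _ _ _ Si).
have i1 : indep_rv P (fun w => S w ^+ p.*2.+1) (z n).
  exact: (indep_rv_comp (u := fun x => x ^+ p.*2.+1) (v := id) _ _ _ _ Si).
have i2 : indep_rv P (fun w => 1 + S w ^+ p.*2) (fun w => 1 + z n w ^+ p.+1.*2).
  apply: (indep_rv_comp (u := fun x => 1 + x ^+ p.*2)
    (v := fun x => 1 + x ^+ p.+1.*2) _ _ _ _ Si) => //.
  - by apply: measurable_funD => //; exact: measurable_funX.
  - by apply: measurable_funD => //; exact: measurable_funX.
have tz1 : tame1 P (fun w => 1 + z n w ^+ p.+1.*2).
  by apply: tame1D; [exact: tame1_cst|exact: tame1X].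
have tS1 : tame1 P (fun w => 1 + S w ^+ p.*2).
  by apply: tame1D; [exact: tame1_cst|exact: tame1X].
have tSX u : tame1 P (fun w => S w ^+ u) by exact: tame1X.
have t2 : tame1 P (fun w => S w ^+ p.*2.+1 * z n w) by exact: tame1M.
have t2' := tame1Z p.+1.*2%:R t2.
have t3 := tame1M tS1 tz1; have t3' := tame1Z B t3.
have t12 := tame1D (tSX p.+1.*2) t2'.
apply: (@le_trans _ _ (Ex (fun w => S w ^+ p.+1.*2 +
    p.+1.*2%:R * (S w ^+ p.*2.+1 * z n w) +
    B * ((1 + S w ^+ p.*2) * (1 + z n w ^+ p.+1.*2))))).
  apply: Ex_le => [||w].
  - exact: tame1X.
  - exact: tame1D t12 t3'.
  - by rewrite big_ord_recr; exact: HB.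
rewrite (ExD t12 t3') (ExD (tSX _) t2') (ExZ _ t2) (ExZ _ t3).
rewrite (ExM (tSX _) (tz n) i1) (ExM tS1 tz1 i2).
rewrite (z0 n)// !mulr0 addr0.
rewrite !ExD ?Ex_cst; do ?[exact: tame1_cst|exact: tame1X].
have Mz : Ex (fun w => z n w ^+ p.+1.*2) <= `|M p.+1|.
  exact: le_trans (mz _ _) (ler_norm _).
have E0 f : tame1 P f -> (forall w, 0 <= f w) -> 0 <= Ex f.
  by move=> tf f0; apply: Rintegral_ge0.
have Ez0 : 0 <= Ex (fun w => z n w ^+ p.+1.*2).
  by apply: E0 => [|w]; [exact: tame1X|exact: expn_double_ge0].
have ES0 : 0 <= Ex (fun w => S w ^+ p.*2).
  by apply: E0 => [|w]; [exact: tame1X|exact: expn_double_ge0].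
apply: (@le_trans _ _ (D * n%:R ^+ p.+1 + D * n.+1%:R ^+ p)).
  apply: lerD => //; rewrite /D -mulrA ler_wpM2l// -[X in _ <= X]mulrA.
  rewrite [X in _ <= _ * X]mulrC [X in _ <= X]mulrA.
  apply: ler_pM; rewrite ?addr_ge0//; last by rewrite lerD2l.
  rewrite mulrDl mul1r lerD//.
    by rewrite exprn_ege1// ler1n.
  rewrite (le_trans IH)// ler_wpM2l// lerXn2r ?nnegrE ?ler0n// ler_nat.
  exact: leqnSn.
have D0 : 0 <= D by rewrite !mulr_ge0 ?addr_ge0.
rewrite -mulrDr ler_wpM2l//.
rewrite [X in _ <= X]exprSr -[in X in _ <= _ * X]natr1 mulrDr mulr1 lerD2r exprSr.
rewrite ler_wpM2r ?ler0n// lerXn2r ?nnegrE ?ler0n// ler_nat.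
exact: leqnSn.
Qed.

End moments_of_sums.

(** * Closeness at rate 1 / sqrt N and the law of large numbers *)

Section closeness.
Context (d : measure_display) (T : measurableType d) (R : realType).
Variable P : probability T R.
Context (I : Type) (N : I -> nat).
Hypothesis N_ge2 : forall i, (2 <= N i)%N.
Implicit Types X Y : I -> T -> R.

Definition close X Y : Prop :=
  [/\ tame P X, tame P Y &
      tame P (fun i w => Num.sqrt (N i)%:R * (X i w - Y i w))].

Let N_ge1 i : 1 <= (N i)%:R :> R.
Proof. by rewrite (ler_nat R 1) (leq_trans _ (N_ge2 i)). Qed.

Let sqrtN_ge1 i : 1 <= Num.sqrt (N i)%:R :> R.
Proof. by rewrite -[leLHS]sqrtr1 ler_wsqrtr. Qed.

(** X = Y + (X - Y) is tame because sqrt N >= 1. *)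
Lemma close_of X Y : (forall i, measurable_fun setT (X i)) -> tame P Y ->
  tame P (fun i w => Num.sqrt (N i)%:R * (X i w - Y i w)) -> close X Y.
Proof.
move=> mX tY tXY; split=> //.
apply: (@tame_le _ _ _ _ _ _
  (fun i w => `|Num.sqrt (N i)%:R * (X i w - Y i w)| + `|Y i w|)) => //.
  by apply: tameD; apply: tame_norm.
move=> i w; rewrite [X in _ <= X]ger0_norm ?addr_ge0// normrM.
rewrite [`|Num.sqrt _|]ger0_norm ?sqrtr_ge0//.
rewrite -{1}(subrK (Y i w) (X i w)) (le_trans (ler_normD _ _))// lerD2r.
by rewrite ler_peMl.
Qed.

Lemma close_refl X : tame P X -> close X X.
Proof.
move=> tX; split=> //; under eq_fun do under eq_fun do rewrite subrr mulr0.
exact: tame_cst.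
Qed.

Lemma close_cst (c : R) : close (fun _ _ => c) (fun _ _ => c).
Proof. exact/close_refl/tame_cst. Qed.

Lemma closeD X Y X' Y' : close X Y -> close X' Y' ->
  close (fun i w => X i w + X' i w) (fun i w => Y i w + Y' i w).
Proof.
move=> [tX tY tXY] [tX' tY' tXY']; split; do ?exact: tameD.
have := tameD tXY tXY'; congr (tame _ _).
by apply/funext => i; apply/funext => w; ring.
Qed.

Lemma closeM X Y X' Y' : close X Y -> close X' Y' ->
  close (fun i w => X i w * X' i w) (fun i w => Y i w * Y' i w).
Proof.
move=> [tX tY tXY] [tX' tY' tXY']; split; do ?exact: tameM.
have := tameD (tameM tXY tX') (tameM tY tXY'); congr (tame _ _).
by apply/funext => i; apply/funext => w; ring.
Qed.

Lemma closeZ c X Y : close X Y ->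
  close (fun i w => c * X i w) (fun i w => c * Y i w).
Proof. by move=> XY; apply: closeM XY; exact: close_cst. Qed.

Lemma closeB X Y X' Y' : close X Y -> close X' Y' ->
  close (fun i w => X i w - X' i w) (fun i w => Y i w - Y' i w).
Proof.
move=> XY XY'; have := closeD XY (closeZ (-1) XY').
by congr close; apply/funext => i; apply/funext => w; rewrite mulN1r.
Qed.

Lemma close_sum J (s : seq J) (X Y : J -> I -> T -> R) :
  (forall j, close (X j) (Y j)) ->
  close (fun i w => \sum_(j <- s) X j i w) (fun i w => \sum_(j <- s) Y j i w).
Proof.
move=> XY; elim: s => [|j s IH].
  have := close_cst 0; congr close; apply/funext => i; apply/funext => w;
  by rewrite big_nil.
have := closeD (XY j) IH; congr close; apply/funext => i; apply/funext => w;
by rewrite big_cons.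
Qed.

(** sqrt N times the error of the average is S_N / sqrt N for the centred sum S_N,
    and its 2p-th moment is bounded because that of S_N is of order N ^ p. *)
Lemma lln (Z : I -> nat -> T -> R) (mu : R) :
  tame P (fun ij : I * nat => Z ij.1 ij.2) ->
  (forall i j, (j < N i)%N -> Ex P (Z i j) = mu) ->
  (forall i k, (k < N i)%N ->
     indep_rv P (fun w => \sum_(j < k) Z i j w) (Z i k)) ->
  close (fun i w => (N i)%:R^-1 * \sum_(j < N i) Z i j w) (fun _ _ => mu).
Proof.
move=> tZ EZ iZ.
have tZ1 i j : tame1 P (Z i j) by exact: (tame1_of (i, j) tZ).
have tS i k : tame1 P (fun w => \sum_(j < k) Z i j w).
  by apply: (@tame1_sum _ _ _ P _ _ (fun (j : 'I_k) => Z i j)).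
have tA i : tame1 P (fun w => (N i)%:R^-1 * \sum_(j < N i) Z i j w).
  exact/tame1Z/tS.
apply: close_of => [i||]; [exact: tame1_measurable (tA i)|exact: tame_cst|].
pose z i j w := Z i j w - mu.
have tz : tame P (fun ij : I * nat => z ij.1 ij.2).
  by apply: tameB => //; exact: tame_cst.
have tz1 i j : tame1 P (z i j) by exact: (tame1_of (i, j) tz).
have Sz i k w : \sum_(j < k) z i j w = \sum_(j < k) Z i j w - k%:R * mu.
  by rewrite big_split/= sumr_const card_ord mulNrn mulr_natl.
have SE i w : Num.sqrt (N i)%:R * ((N i)%:R^-1 * \sum_(j < N i) Z i j w - mu) =
    (Num.sqrt (N i)%:R)^-1 * \sum_(j < N i) z i j w :> R.
  have N0 : (N i)%:R != 0 :> R by rewrite gt_eqF// (lt_le_trans _ (N_ge1 i)).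
  have s0 : Num.sqrt (N i)%:R != 0 :> R.
    by rewrite gt_eqF// (lt_le_trans _ (sqrtN_ge1 i)).
  rewrite Sz -[X in X^-1 * _](sqr_sqrtr (ler0n _ _)) -[X in X * mu](sqr_sqrtr (ler0n _ _)).
  by field.
have /boolp.choice[M Mz] : forall r, exists C, forall ij : I * nat,
    Ex P (fun w => `|z ij.1 ij.2 w| ^+ r.*2) <= C.
  by move=> r; exact: (tame_Ex r.*2 tz).
apply: tame_of_even_moments => [i|p].
  apply: tame1Z; apply: tame1D => //; exact: tame1_cst.
have [C C0 HC] := sum_moment_bound P M p.
exists C => i.
rewrite (@eq_Ex _ _ _ _ _ (fun w =>
  ((N i)%:R ^+ p)^-1 * (\sum_(j < N i) z i j w) ^+ p.*2)); last first.
  move=> w; rewrite SE exprMn exprVn -mul2n exprM sqr_sqrtr ?ler0n//.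
have tSz k : tame1 P (fun w => \sum_(j < k) z i j w).
  by apply: (@tame1_sum _ _ _ P _ _ (fun (j : 'I_k) => z i j)).
rewrite ExZ; last exact: tame1X.
rewrite mulrC ler_pdivrMr ?exprn_gt0// ?(lt_le_trans _ (N_ge1 i))//.
apply: HC => //.
- by move=> j r; have := Mz r (i, j); under eq_Ex do rewrite norm_expn_double.
- move=> j jN; have := ExD (tZ1 i j) (tame1_cst P (- mu)).
  by rewrite Ex_cst EZ// subrr.
- move=> k kN.
  apply: (indep_rv_comp (u := fun x => x - k%:R * mu) (v := fun x => x - mu)
    _ _ _ _ (iZ i k kN)) => //.
  + exact: measurable_funB.
  + exact: measurable_funB.
  + by apply/funext => w; rewrite Sz.
Qed.

(** The factor N / (N - 1) turning the biased sample covariance into the unbiased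
    one. *)
Lemma close_bessel :
  close (fun i _ => (N i)%:R / ((N i)%:R - 1)) (fun _ _ => 1).
Proof.
have N2 i : 2 <= (N i)%:R :> R by rewrite (ler_nat R 2).
apply: close_of => [i||]; [exact: measurable_cst|exact: tame_cst|].
apply: (@tame_bounded _ _ _ _ _ _ 2) => i.
have N1 : 0 < (N i)%:R - 1 :> R by have := N2 i; lra.
have -> : (N i)%:R / ((N i)%:R - 1) - 1 = ((N i)%:R - 1)^-1 :> R.
  by field; rewrite gt_eqF.
rewrite ger0_norm ?mulr_ge0 ?sqrtr_ge0 ?invr_ge0 ?(ltW N1)//.
rewrite ler_pdivrMr//.
apply: (@le_trans _ _ (N i)%:R); last by have := N2 i; lra.
rewrite -[X in _ <= X](sqr_sqrtr (ler0n _ _)) expr2 ler_peMl ?sqrtr_ge0//.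
Qed.

(** The sample covariance is N / (N - 1) times the average of the products minus the
    product of the averages. *)
Lemma close_sample_covariance (x y : I -> nat -> T -> R) (mx my mxy : R) :
  let avg z i w := (N i)%:R^-1 * \sum_(j < N i) z i j w in
  close (avg x) (fun _ _ => mx) -> close (avg y) (fun _ _ => my) ->
  close (avg (fun i j w => x i j w * y i j w)) (fun _ _ => mxy) ->
  close (fun i w => ((N i)%:R - 1)^-1 *
           \sum_(j < N i) (x i j w - avg x i w) * (y i j w - avg y i w))
        (fun _ _ => mxy - mx * my).
Proof.
move=> avg cx cy cxy.
have := closeM close_bessel (closeB cxy (closeM cx cy)).
congr close; apply/funext => i; apply/funext => w; last by rewrite mul1r.
have N0 : (N i)%:R != 0 :> R by rewrite gt_eqF// (lt_le_trans _ (N_ge1 i)).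
set Sx := \sum_(j < N i) x i j w; set Sy := \sum_(j < N i) y i j w.
have -> : \sum_(j < N i) (x i j w - avg x i w) * (y i j w - avg y i w) =
    \sum_(j < N i) x i j w * y i j w - avg x i w * Sy - avg y i w * Sx
    + (N i)%:R * (avg x i w * avg y i w).
  rewrite /Sx /Sy !mulr_sumr -!sumrB.
  have -> : (N i)%:R * (avg x i w * avg y i w) =
      \sum_(j < N i) avg x i w * avg y i w.
    by rewrite sumr_const card_ord mulr_natl.
  by rewrite -big_split/=; apply: eq_bigr => j _; ring.
rewrite /avg -/Sx -/Sy.
set Sxy := \sum_(j < N i) x i j w * y i j w.
set c := ((N i)%:R - 1)^-1.
by field.
Qed.

End closeness.

(** * Moments of one-dimensional Gaussian laws *)

Section normal_integrals.
Context {R : realType}.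
Local Notation mu := (@lebesgue_measure R).

(** The Gaussian density is the Radon-Nikodym derivative up to a negligible set. *)
Lemma integral_normal_prob (m s : R) (f : R -> \bar R) :
  measurable_fun setT f -> (forall x, 0 <= f x)%E ->
  (\int[normal_prob m s]_x f x = \int[mu]_x (f x * (normal_pdf m s x)%:E))%E.
Proof.
move=> mf f0; have dom := normal_prob_dominates m s.
have mpdf : measurable_fun setT (EFin \o normal_pdf m s).
  by apply/measurable_EFinP; exact: measurable_normal_pdf.
have mg := measurable_int _ (Radon_Nikodym_SigmaFinite.f_integrable dom).
rewrite -(Radon_Nikodym_SigmaFinite.change_of_variables dom)//.
apply: ae_eq_integral => //.
- exact: emeasurable_funM.
- exact: emeasurable_funM.
- apply: ae_eqe_mul2l; apply: integral_ae_eq => //.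
    exact: Radon_Nikodym_SigmaFinite.f_integrable.
  by move=> A _ mA; rewrite -Radon_Nikodym_SigmaFinite.f_integral.
Qed.

(** Multiplying the density by an exponential gives, up to a constant, the density
    with mean shifted by l s ^ 2 (completion of the square). *)
Lemma normal_mgf (m s l : R) : s != 0 ->
  (\int[normal_prob m s]_x (expR (l * x))%:E =
   (expR (l * m + l ^+ 2 * s ^+ 2 / 2))%:E)%E.
Proof.
move=> s0.
have mh : measurable_fun setT (fun x : R => expR (l * x)).
  by apply: measurableT_comp => //; exact: measurable_funM.
rewrite (integral_normal_prob m s (iffRL (measurable_EFinP _ _) mh)); last first.
  by move=> x /=; rewrite lee_fin expR_ge0.
transitivity (\int[mu]_x ((expR (l * m + l ^+ 2 * s ^+ 2 / 2))%:E *
    (normal_pdf (m + l * s ^+ 2) s x)%:E))%E.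
  apply: eq_integral => x _; rewrite -!EFinM !normal_pdfE// /normal_fun; congr EFin.
  rewrite mulrCA [RHS]mulrCA -!expRD; congr (_ * expR _).
  by field.
rewrite integralZl//; last exact: integrable_normal_pdf.
by rewrite integral_normal_pdf mule1.
Qed.

(** Multiplying the density by this Gaussian factor gives r times the density with
    standard deviation r s. *)
Lemma normal_gauss_integral (m s r : R) : s != 0 -> 0 < r ->
  (\int[normal_prob m s]_x
     (expR (- ((r ^- 2 - 1) / (2 * s ^+ 2)) * (x - m) ^+ 2))%:E = r%:E)%E.
Proof.
move=> s0 r0.
have mh : measurable_fun setT
    (fun x : R => expR (- ((r ^- 2 - 1) / (2 * s ^+ 2)) * (x - m) ^+ 2)).
  apply: measurableT_comp => //; apply: measurable_funM => //.
  by apply: measurable_funX; exact: measurable_funB.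
rewrite (integral_normal_prob m s (iffRL (measurable_EFinP _ _) mh)); last first.
  by move=> x /=; rewrite lee_fin expR_ge0.
have rs0 : r * s != 0 by rewrite mulf_neq0// gt_eqF.
transitivity (\int[mu]_x (r%:E * (normal_pdf m (r * s) x)%:E))%E.
  apply: eq_integral => x _; rewrite -!EFinM !normal_pdfE// /normal_fun; congr EFin.
  have -> : normal_peak s = r * normal_peak (r * s).
    rewrite /normal_peak.
    have -> : (r * s) ^+ 2 * pi *+ 2 = r ^+ 2 * (s ^+ 2 * pi *+ 2) by ring.
    rewrite (sqrtrM _ (sqr_ge0 r)) sqrtr_sqr gtr0_norm// invfM mulrA divff ?mul1r//.
    by rewrite gt_eqF.
  rewrite mulrCA -!mulrA -expRD; congr (_ * (_ * expR _)).
  by field; rewrite s0 gt_eqF.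
rewrite integralZl//; last exact: integrable_normal_pdf.
by rewrite integral_normal_pdf mule1.
Qed.

End normal_integrals.

Lemma slope_eq0 (R : realFieldType) (D v : R) : 0 <= v ->
  (forall l, l ^+ 2 * v <= 1 -> l * D <= l ^+ 2 * v) -> D = 0.
Proof.
move=> v_ge0 lD; apply/eqP; apply: contraT => D0.
(* This l makes l ^ 2 * v smaller than both 1 and l * D. *)
pose l := D / ((1 + D ^+ 2) * (1 + v)).
have D2 : 0 < D ^+ 2 by rewrite exprn_even_gt0.
have Dv : 0 <= D ^+ 2 * v by rewrite mulr_ge0// ltW.
have c0 : 0 < (1 + D ^+ 2) * (1 + v) by rewrite mulr_gt0//; lra.
have lE : l * ((1 + D ^+ 2) * (1 + v)) = D by rewrite /l divfK// gt_eqF.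
have l2 : l ^+ 2 * ((1 + D ^+ 2) * (1 + v)) = l * D.
  by rewrite -[in RHS]lE; ring.
have l20 : 0 < l ^+ 2.
  rewrite exprn_even_gt0//=; apply: contra_neq D0 => l0.
  by rewrite -lE l0 mul0r.
have cD : D ^+ 2 <= (1 + D ^+ 2) * (1 + v) by lra.
have cv : v <= (1 + D ^+ 2) * (1 + v) by lra.
have lv1 : l ^+ 2 * v <= 1.
  rewrite /l expr_div_n mulrAC ler_pdivrMr ?exprn_gt0// mul1r.
  by rewrite [leRHS]expr2 ler_pM// ltW.
have := lD l lv1; rewrite -l2 ler_pM2l//; lra.
Qed.

(** Dividing by r - 1 bounds s by 2 v r ^ 2 / (1 + r) from below for r < 1 and from
    above for r > 1, and both bounds tend to v as r tends to 1. *)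
Lemma pinched_eq (R : realFieldType) (s v : R) : 0 < v ->
  (forall r, 0 < r -> (r ^+ 2 - 1) * s <= 2 * v * (r - 1) * r ^+ 2) -> s = v.
Proof.
move=> v0 key.
have near e : 0 < e -> e < 1 -> `|s - v| <= 2 * v * e.
  move=> e0 e1; rewrite ler_distl; have ve := mulr_gt0 v0 e0.
  have vee := mulr_gt0 ve e0; apply/andP; split.
    have r0 : 0 < 1 - e by lra.
    have h : 2 * v * (1 - e) ^+ 2 <= (2 - e) * s.
      by rewrite -(ler_pM2l e0); have := key _ r0; nra.
    have c0 : 0 < 2 - e by lra.
    by rewrite -(ler_pM2l c0); nra.
  have r0 : 0 < 1 + e by lra.
  have h : (2 + e) * s <= 2 * v * (1 + e) ^+ 2.
    by rewrite -(ler_pM2l e0); have := key _ r0; nra.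
  have c0 : 0 < 2 + e by lra.
  by rewrite -(ler_pM2l c0); nra.
apply/eqP; rewrite -subr_eq0 -normr_le0; apply/ler_addgt0Pl => e e0.
rewrite addr0; pose u := Num.min (2^-1) (e / (2 * v)).
have u0 : 0 < u by rewrite lt_min invr_gt0 ltr0n divr_gt0//= mulr_gt0.
have u1 : u < 1 by rewrite gt_min invf_lt1 ?ltr1n.
apply: (le_trans (near u u0 u1)).
have : u <= e / (2 * v) by rewrite ge_min lexx orbT.
by rewrite ler_pdivlMr ?mulr_gt0// mulrC.
Qed.

Section gaussian_variable.
Context (d : measure_display) (T : measurableType d) (R : realType).
Variable P : probability T R.

Lemma law_integral d' (U : measurableType d') (nu : {measure set U -> \bar R})
    (f : T -> U) (h : U -> R) :
  measurable_fun setT f -> measurable_fun setT h -> (forall x, 0 <= h x) ->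
  (forall B, measurable B -> P (f @^-1` B) = nu B) ->
  (\int[P]_w (h (f w))%:E = \int[nu]_x (h x)%:E)%E.
Proof.
move=> mf mh h0 law.
pose f' : {mfun T >-> U} := HB.pack f (isMeasurableFun.Build _ _ _ _ f mf).
transitivity (\int[distribution P f']_x (h x)%:E)%E.
  rewrite ge0_integral_distribution//; first exact/measurable_EFinP.
by apply: eq_measure_integral => A mA _; exact: law.
Qed.

Variables (f : T -> R) (m v : R).
Hypotheses (mf : measurable_fun setT f) (v_ge0 : 0 <= v).
Hypothesis f_law : forall B, measurable B -> P (f @^-1` B) = gaussian_law m v B.

Let dirac_law : v = 0 -> forall B, measurable B -> P (f @^-1` B) = dirac m B.
Proof. by move=> v0 B mB; rewrite f_law// /gaussian_law v0 eqxx. Qed.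

Let normal_law : v != 0 ->
  forall B, measurable B -> P (f @^-1` B) = normal_prob m (Num.sqrt v) B.
Proof. by move=> v0 B mB; rewrite f_law// /gaussian_law (negbTE v0). Qed.

Let normal_integral (h : R -> R) : v != 0 ->
  measurable_fun setT h -> (forall x, 0 <= h x) ->
  (\int[P]_w (h (f w))%:E = \int[normal_prob m (Num.sqrt v)]_x (h x)%:E)%E.
Proof.
move=> v0 mh h0.
exact: (@law_integral _ (measurableTypeR R) (normal_prob m (Num.sqrt v)) f h mf mh h0
  (normal_law v0)).
Qed.

Let sqrtv0 : v != 0 -> Num.sqrt v != 0.
Proof. by move=> v0; rewrite gt_eqF// sqrtr_gt0 lt_def v0. Qed.

Lemma gaussian_mgf l :
  (\int[P]_w (expR (l * f w))%:E = (expR (l * m + l ^+ 2 * v / 2))%:E)%E.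
Proof.
have mh : measurable_fun setT (fun x : R => expR (l * x)).
  by apply: measurableT_comp => //; exact: measurable_funM.
have [v0|v0] := eqVneq v 0.
  rewrite (law_integral mf mh (fun=> expR_ge0 _) (dirac_law v0)).
  rewrite integral_dirac ?diracT//=; last exact/measurable_EFinP.
  by rewrite mul1e v0 mulr0 mul0r addr0.
rewrite (normal_integral v0 mh (fun=> expR_ge0 _)).
by rewrite normal_mgf ?sqrtv0// sqr_sqrtr.
Qed.

Lemma norm_expn_le_expR (x : R) p :
  `|x| ^+ p <= p%:R ^+ p * (expR x + expR (- x)).
Proof.
have e1 : expR `|x| <= expR x + expR (- x).
  by case: ger0P => _; rewrite ?lerDl ?lerDr ?expR_ge0.
case: p => [|p].
  rewrite !expr0 mul1r (le_trans _ e1)//.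
  by rewrite (le_trans _ (expR_ge1Dx _))// lerDl.
apply: le_trans (ler_wpM2l _ e1); last by rewrite exprn_ge0.
have -> : expR `|x| = expR (`|x| / p.+1%:R) ^+ p.+1.
  by rewrite -expRM_natl mulrC divfK.
rewrite -exprMn lerXn2r ?nnegrE ?mulr_ge0 ?expR_ge0//.
rewrite -ler_pdivrMl// mulrC (le_trans _ (expR_ge1Dx _))//.
by rewrite lerDr.
Qed.

Lemma gaussian_abs_moment p : (abs_moment P p f <=
  (p%:R ^+ p * (expR (1 * m + 1 ^+ 2 * v / 2) +
                expR (- 1 * m + (- 1) ^+ 2 * v / 2)))%:E)%E.
Proof.
have e l : measurable_fun setT (fun w => expR (l * f w)).
  by apply: measurableT_comp => //; exact: measurable_funM.
apply: (integral_le_bound (P := P) (a := fun w => expR (1 * f w))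
  (b := fun w => expR (- 1 * f w))) => //.
- exact: measurable_abs_expn.
- by move=> w; rewrite mul1r mulN1r norm_expn_le_expR.
- by rewrite gaussian_mgf.
- by rewrite gaussian_mgf.
Qed.

Lemma gaussian_tame1 : tame1 P f.
Proof.
by split=> [_//|p]; eexists => _; exact: gaussian_abs_moment.
Qed.

Let tame1_center l : tame1 P (fun w => l * (f w - m)).
Proof. apply/tame1Z/tame1D; [exact: gaussian_tame1|exact: tame1_cst]. Qed.

(** Integrate 1 + x <= exp x at x = l (f - m). *)
Let exp_bound l : 1 + l * (Ex P f - m) <= expR (l ^+ 2 * v / 2).
Proof.
have -> : 1 + l * (Ex P f - m) = Ex P (fun w => 1 + l * (f w - m)).
  rewrite ExD ?Ex_cst//; last exact: tame1_cst.
  rewrite ExZ ?ExD ?Ex_cst//; do ?exact: tame1_cst; do ?exact: gaussian_tame1.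
  apply: tame1D; [exact: gaussian_tame1|exact: tame1_cst].
have t1 : tame1 P (fun w => 1 + l * (f w - m)).
  by apply: tame1D => //; exact: tame1_cst.
have e : measurable_fun setT (fun w => expR (l * f w)).
  by apply: measurableT_comp => //; exact: measurable_funM.
rewrite -lee_fin -ExE//.
have -> : (expR (l ^+ 2 * v / 2))%:E =
    ((expR (- (l * m)))%:E * \int[P]_w (expR (l * f w))%:E)%E.
  by rewrite gaussian_mgf -EFinM -expRD; congr (expR _)%:E; ring.
rewrite -ge0_integralZl_EFin ?expR_ge0//; last exact/measurable_EFinP.
apply: le_integral => //.
- exact: tame1_integrable.
- apply: integrableZl => //; apply/integrableP; split; first exact/measurable_EFinP.
  under eq_integral do rewrite gee0_abs ?lee_fin ?expR_ge0//.
  by rewrite gaussian_mgf ltry.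
- move=> w _; rewrite -EFinM lee_fin -expRD.
  have -> : - (l * m) + l * f w = l * (f w - m) by ring.
  exact: expR_ge1Dx.
Qed.

Let small_exp (y : R) : 0 <= y -> y <= 2^-1 -> expR y <= 1 + 2 * y.
Proof.
move=> y0 y1; have := expR_ge1Dx (- y); rewrite expRN => h.
have e0 := expR_gt0 y.
have : (1 - y) * expR y <= 1.
  by rewrite -[leRHS](mulVf (lt0r_neq0 e0)) ler_wpM2r// ltW.
nra.
Qed.

(** For every small l the bound [exp_bound] gives l (E f - m) <= l ^ 2 v. *)
Lemma gaussian_mean : Ex P f = m.
Proof.
set D := Ex P f - m.
have lD l : l ^+ 2 * v <= 1 -> l * D <= l ^+ 2 * v.
  move=> lv; have := exp_bound l; rewrite -/D => h.
  have lv0 : 0 <= l ^+ 2 * v by rewrite mulr_ge0// sqr_ge0.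
  have := @small_exp (l ^+ 2 * v / 2); nra.
by apply/eqP; rewrite -subr_eq0 -/D (slope_eq0 v_ge0 lD).
Qed.

Let tame1_sq : tame1 P (fun w => (f w - m) ^+ 2).
Proof.
apply/tame1X/tame1D; [exact: gaussian_tame1|exact: tame1_cst].
Qed.

(** Integrate 1 + x <= exp x at x = - h (f - m) ^ 2; h has either sign, according
   to whether r is below or above 1. *)
Let gauss_bound r : v != 0 -> 0 < r ->
  1 - (r ^- 2 - 1) / (2 * v) * Ex P (fun w => (f w - m) ^+ 2) <= r.
Proof.
move=> v0 r0; set h := (r ^- 2 - 1) / (2 * v).
have mh : measurable_fun setT (fun x : R => expR (- h * (x - m) ^+ 2)).
  apply: measurableT_comp => //; apply: measurable_funM => //.
  by apply: measurable_funX; exact: measurable_funB.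
have rE : (\int[P]_w (expR (- h * (f w - m) ^+ 2))%:E = r%:E)%E.
  rewrite (normal_integral v0 mh (fun=> expR_ge0 _)).
  by rewrite -(normal_gauss_integral m (sqrtv0 v0) r0) sqr_sqrtr.
have t1 : tame1 P (fun w => - h * (f w - m) ^+ 2) by exact: tame1Z.
have t2 : tame1 P (fun w => 1 + - h * (f w - m) ^+ 2).
  by apply: tame1D => //; exact: tame1_cst.
have -> : 1 - h * Ex P (fun w => (f w - m) ^+ 2) =
    Ex P (fun w => 1 + - h * (f w - m) ^+ 2).
  by rewrite ExD ?Ex_cst ?ExZ ?mulNr//; exact: tame1_cst.
have me := measurableT_comp mh mf.
rewrite -lee_fin -ExE// -rE; apply: le_integral => //.
- exact: tame1_integrable.
- apply/integrableP; split; first exact/measurable_EFinP.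
  under eq_integral do rewrite gee0_abs ?lee_fin ?expR_ge0//.
  by rewrite rE ltry.
- by move=> w _; rewrite lee_fin expR_ge1Dx.
Qed.

(** The inequality [gauss_bound], valid on both sides of r = 1, determines the
    second moment: it is the derivative of the normalizing constant in disguise. *)
Lemma gaussian_variance : Ex P (fun w => (f w - m) ^+ 2) = v.
Proof.
have [v0|v0] := eqVneq v 0.
  apply: EFin_inj; rewrite -ExE//.
  have mh : measurable_fun setT (fun x : R => (x - m) ^+ 2).
    by apply: measurable_funX; exact: measurable_funB.
  rewrite (law_integral mf mh (fun=> sqr_ge0 _) (dirac_law v0)).
  rewrite integral_dirac ?diracT//=; last exact/measurable_EFinP.
  by rewrite mul1e subrr expr0n v0.
have vp : 0 < v by rewrite lt_def v0.
set s := Ex P _; have s0 : 0 <= s.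
  by apply: Rintegral_ge0 => w _; exact: sqr_ge0.
have key r : 0 < r -> (r ^+ 2 - 1) * s <= 2 * v * (r - 1) * r ^+ 2.
  move=> r0; have := gauss_bound v0 r0; rewrite -/s.
  have -> : 1 - (r ^- 2 - 1) / (2 * v) * s =
      1 + (r ^+ 2 - 1) * s / (2 * v * r ^+ 2).
    by field; rewrite v0 gt_eqF.
  have c0 : 0 < 2 * v * r ^+ 2 by rewrite !mulr_gt0 ?exprn_gt0.
  rewrite -lerBrDl ler_pdivrMr//; nra.
exact: pinched_eq vp key.
Qed.

Lemma gaussian_second_moment : Ex P (fun w => f w ^+ 2) = v + m ^+ 2.
Proof.
have tf := gaussian_tame1.
rewrite (@eq_Ex _ _ _ P _ (fun w =>
  (f w - m) ^+ 2 + (2 * m * f w + - m ^+ 2))); last by move=> w; ring.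
rewrite ExD ?ExD ?ExZ ?Ex_cst ?gaussian_variance ?gaussian_mean//.
- by ring.
- exact: tame1Z.
- exact: tame1_cst.
- by apply: tame1D; [exact: tame1Z|exact: tame1_cst].
Qed.

End gaussian_variable.

(** * Gaussian vectors and generated sigma-algebras *)

Section gaussian_vectors.
Context (d : measure_display) (T : measurableType d) (R : realType).
Variable P : probability T R.

Lemma tame_gaussian_family I (X : I -> T -> R) (m v : I -> R) (b c : R) :
  (forall i, measurable_fun setT (X i)) ->
  (forall i, `|m i| <= b) -> (forall i, 0 <= v i) -> (forall i, v i <= c) ->
  (forall i B, measurable B -> P (X i @^-1` B) = gaussian_law (m i) (v i) B) ->
  tame P X.
Proof.
move=> mX mb v0 vc law; split=> // p.
exists (p%:R ^+ p * (expR (b + c / 2) + expR (b + c / 2))) => i.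
apply: (le_trans (gaussian_abs_moment (mX i) (v0 i) (law i) p)).
have := mb i; rewrite ler_norml => /andP[mb1 mb2]; have := vc i => vc1.
rewrite lee_fin ler_wpM2l ?exprn_ge0//.
by apply: lerD; rewrite ler_expR ?sqrrN expr1n; lra.
Qed.

Variables (n : nat) (m : 'cV[R]_n) (S : 'M[R]_n) (X : T -> 'cV[R]_n).
Hypothesis gX : gaussian_vector P m S X.

Lemma gaussian_vector_measurable a : measurable_fun setT (fun w => X w a 0).
Proof. by case: gX. Qed.

Lemma inner_delta (a : 'I_n) (u : 'cV[R]_n) : inner (delta_mx a 0) u = u a 0.
Proof.
rewrite /inner (bigD1 a)//= big1 => [|i ia]; rewrite !mxE !eqxx ?mul1r ?addr0//.
by rewrite (negbTE ia) mul0r.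
Qed.

Lemma innerDl (u u' v : 'cV[R]_n) : inner (u + u') v = inner u v + inner u' v.
Proof.
by rewrite /inner -big_split; apply: eq_bigr => i _; rewrite mxE mulrDl.
Qed.

Lemma mulmx_delta (a b : 'I_n) : (S *m delta_mx b 0 : 'cV[R]_n) a 0 = S a b.
Proof.
rewrite mxE (bigD1 b)//= big1 => [|i ia]; rewrite !mxE !eqxx ?mulr1 ?addr0//.
by rewrite (negbTE ia) mulr0.
Qed.

Let law u B : measurable B -> P ((fun w => inner u (X w)) @^-1` B) =
  gaussian_law (inner u m) (inner u (S *m u)) B.
Proof. by case: gX => _ _; apply. Qed.

Let var_ge0 u : 0 <= inner u (S *m u).
Proof. by case: gX => [[_ +]] _ _; apply. Qed.

Lemma gaussian_vector_entry a B : measurable B ->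
  P ((fun w => X w a 0) @^-1` B) = gaussian_law (m a 0) (S a a) B.
Proof.
move=> mB; have := law (delta_mx a 0) mB.
rewrite inner_delta inner_delta mulmx_delta => <-.
by congr (P _); apply/seteqP; split=> w /=; rewrite inner_delta.
Qed.

Lemma gaussian_vector_var_ge0 a : 0 <= S a a.
Proof. by have := var_ge0 (delta_mx a 0); rewrite inner_delta mulmx_delta. Qed.

Lemma gaussian_vector_tame1 a : tame1 P (fun w => X w a 0).
Proof.
apply: (gaussian_tame1 (gaussian_vector_measurable a)
  (gaussian_vector_var_ge0 a)) => B; exact: gaussian_vector_entry.
Qed.

Let second_moment a : Ex P (fun w => X w a 0 ^+ 2) = S a a + m a 0 ^+ 2.
Proof.
apply: (gaussian_second_moment (gaussian_vector_measurable a)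
  (gaussian_vector_var_ge0 a)) => B; exact: gaussian_vector_entry.
Qed.

(** Polarization: the second moments of X a, X b and X a + X b are known because all
    three are Gaussian. *)
Lemma gaussian_vector_cov a b :
  Ex P (fun w => X w a 0 * X w b 0) = S a b + m a 0 * m b 0.
Proof.
have ta := gaussian_vector_tame1 a; have tb := gaussian_vector_tame1 b.
pose u : 'cV[R]_n := delta_mx a 0 + delta_mx b 0.
have uX v : inner u v = v a 0 + v b 0 by rewrite innerDl !inner_delta.
have mS : measurable_fun setT (fun w => X w a 0 + X w b 0).
  by apply: measurable_funD; exact: gaussian_vector_measurable.
have Sba : S b a = S a b by case: gX => [[/matrixP/(_ a b)]]; rewrite mxE.
have var : inner u (S *m u) = S a a + S b b + 2 * S a b.
  rewrite uX mulmxDr !mxE.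
  have E (i j : 'I_n) : \sum_k S i k * (delta_mx j 0 : 'cV[R]_n) k 0 = S i j.
    by have := mulmx_delta i j; rewrite mxE.
  by rewrite !E Sba; ring.
have v0 := var_ge0 u; rewrite var in v0.
have lawS B : measurable B -> P ((fun w => X w a 0 + X w b 0) @^-1` B) =
    gaussian_law (m a 0 + m b 0) (S a a + S b b + 2 * S a b) B.
  move=> mB; have := law u mB; rewrite var uX => <-.
  by congr (P _); apply/seteqP; split=> w /=; rewrite uX.
have H := gaussian_second_moment mS v0 lawS.
have tab := tame1M ta tb.
have : Ex P (fun w => (X w a 0 + X w b 0) ^+ 2) =
    Ex P (fun w => X w a 0 ^+ 2 + (X w b 0 ^+ 2 + 2 * (X w a 0 * X w b 0))).
  by apply: eq_Ex => w; ring.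
rewrite H ExD; [|exact: tame1X|by apply: tame1D; [exact: tame1X|exact: tame1Z]].
rewrite ExD; [|exact: tame1X|exact: tame1Z].
rewrite ExZ// !second_moment; lra.
Qed.

End gaussian_vectors.

Section sigma_algebras.
Context (d : measure_display) (T : measurableType d) (R : realType).

Lemma sub_measurable_sigma_rvs (I : Type) (D : set I) (f : I -> T -> R) i :
  D i -> sub_measurable (sigma_rvs D f) (f i).
Proof.
move=> Di; apply/sub_measurableP => B mB; apply: sub_gen_smallest.
by apply: sub_gen_smallest; exists i => //; exists B => //; rewrite setTI.
Qed.

Lemma sigma_rvs_measurable (I : Type) (D : set I) (f : I -> T -> R) :
  (forall i, D i -> measurable_fun setT (f i)) ->
  sigma_rvs D f `<=` measurable.
Proof.
move=> mf; apply: smallest_sub; first exact: sigma_algebra_measurable.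
by move=> _ [i Di [B mB <-]]; exact: mf.
Qed.

Lemma sigma_rvs_setI (I : Type) (D : set I) (f : I -> T -> R) :
  setI_closed (sigma_rvs D f).
Proof.
move=> A B; rewrite /sigma_rvs; set G := \bigcup_(i in D) _ => sA sB.
exact: (@measurableI _ (g_sigma_algebraType G) A B sA sB).
Qed.

Lemma sigma_rvs_setT (I : Type) (D : set I) (f : I -> T -> R) :
  sigma_rvs D f setT.
Proof.
rewrite /sigma_rvs; set G := \bigcup_(i in D) _.
exact: (@measurableT _ (g_sigma_algebraType G)).
Qed.

Lemma sub_measurable_union (K : finType) (G : K -> set (set T)) (J : {set K}) k
    (f : T -> R) :
  k \in J -> sub_measurable (G k) f -> sub_measurable (union_system G J) f.
Proof.
move=> kJ; apply: sub_measurable_trans => A GA.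
by apply: sub_gen_smallest; exists k.
Qed.

End sigma_algebras.

(** * Noise of the particles *)

Section ensemble.
Context (R : realType) (dx dy : nat) (M : model R dx dy).
Context (d : measure_display) (T : measurableType d) (P : probability T R).
Variables (Y : R -> T -> 'cV[R]_dy) (X : R -> T -> 'cV[R]_dx).

Record ensemble := Ensemble {
  ens_size : nat;
  ens_size_ge2 : (2 <= ens_size)%N;
  ens_init : 'I_ens_size -> T -> 'cV[R]_dx;
  ens_W : 'I_ens_size -> R -> T -> 'cV[R]_dx;
  ens_V : 'I_ens_size -> R -> T -> 'cV[R]_dy;
  ens_noise : ensemble_noise M P Y X ens_init ens_W ens_V }.

Hypothesis X_random : forall t, 0 <= t -> random_vector (X t).
Hypothesis Y_random : forall t, 0 <= t -> random_vector (Y t).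

(** The index type of the independent sources: the pair (Y, X), then the initial
   state, the signal noise and the observation noise of each particle. *)
Let label N : finType := (unit + ('I_N + ('I_N + 'I_N)))%type.

Let source (E : ensemble) (j : label (ens_size E)) : set (set T) :=
  match j with
  | inl _ => sigma_process (fun t w => col_mx (Y t w) (X t w))
  | inr (inl i) => sigma_vector (ens_init i)
  | inr (inr (inl i)) => sigma_process (ens_W i)
  | inr (inr (inr i)) => sigma_process (ens_V i)
  end.

Let sigma_process_measurable n (B : R -> T -> 'cV[R]_n) :
  (forall t, 0 <= t -> random_vector (B t)) -> sigma_process B `<=` measurable.
Proof. by move=> mB; apply: sigma_rvs_measurable => -[t i] /= t0; exact: mB. Qed.

Let source_measurable E (j : label (ens_size E)) : source j `<=` measurable.
Proof.
case: j => [_|[i|[i|i]]] /=.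
- apply: sigma_process_measurable => t t0 i.
  rewrite -(splitK i); case: (fintype.split i) => k /=.
    by under eq_fun do rewrite col_mxEu; exact: Y_random.
  by under eq_fun do rewrite col_mxEd; exact: X_random.
- apply: sigma_rvs_measurable => a _.
  exact: gaussian_vector_measurable (en_xi0_law (ens_noise E) i) a.
- apply: sigma_process_measurable; exact: bm_random (en_Wb (ens_noise E) i).
- apply: sigma_process_measurable; exact: bm_random (en_Vb (ens_noise E) i).
Qed.

Let source_setI E (j : label (ens_size E)) : setI_closed (source j).
Proof. by case: j => [_|[i|[i|i]]] /=; exact: sigma_rvs_setI. Qed.

Let source_setT E (j : label (ens_size E)) : source j setT.
Proof. by case: j => [_|[i|[i|i]]] /=; exact: sigma_rvs_setT. Qed.

Let source_indep E : mutually_independent P (@source E).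
Proof. by have := en_independent (ens_noise E). Qed.

Let particles N (p : pred nat) : {set label N} :=
  [set j : label N | match j with
     | inl _ => false
     | inr (inl i) | inr (inr (inl i)) | inr (inr (inr i)) => p i
     end]%SET.

(** The noise of all the particles whose number satisfies p. *)
Definition particle_system (E : ensemble) (p : pred nat) : set (set T) :=
  union_system (@source E) (particles (ens_size E) p).

Let particles_disjoint N (p q : pred nat) : (forall n, p n -> ~~ q n) ->
  forall j, j \in particles N p -> j \notin particles N q.
Proof.
by move=> pq [u|[i|[i|i]]]; rewrite !inE//; exact: pq.
Qed.

Lemma particle_indep E (p q : pred nat) (f g : T -> R) :
  (forall n, p n -> ~~ q n) ->
  sub_measurable (particle_system E p) f ->
  sub_measurable (particle_system E q) g -> indep_rv P f g.
Proof.
move=> pq mf mg; apply: (group_indep_rv (@source_measurable E) (@source_setI E)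
  (@source_setT E) (@source_indep E) _ mf mg).
exact: particles_disjoint.
Qed.

Lemma particle_system_mono E (p q : pred nat) (f : T -> R) : (forall n, p n -> q n) ->
  sub_measurable (particle_system E p) f ->
  sub_measurable (particle_system E q) f.
Proof.
move=> pq; apply: sub_measurable_trans => A [j /= jp GA].
apply: sub_gen_smallest; exists j => //=; move: jp; rewrite !inE.
by case: j {GA} => [//|[i|[i|i]]]; exact: pq.
Qed.

Definition ensemble_mean (z : forall E, 'I_(ens_size E) -> T -> R) E w : R :=
  (ens_size E)%:R^-1 * \sum_i z E i w.

(** Particle k is independent of the sum over the particles before it, so [lln]
    applies. *)
Lemma particle_lln (z : forall E, 'I_(ens_size E) -> T -> R) (mu : R) :
  tame P (fun p : {E & 'I_(ens_size E)} => z (projT1 p) (projT2 p)) ->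
  (forall E i, Ex P (z E i) = mu) ->
  (forall E i, sub_measurable (particle_system E (pred1 (val i))) (z E i)) ->
  close P ens_size (ensemble_mean z) (fun _ _ => mu).
Proof.
move=> tz Ez mz.
pose Z E j w := if insub j is Some i then z E i w else 0.
have ZE E (i : 'I_(ens_size E)) : Z E i = z E i.
  by apply/funext => w; rewrite /Z valK.
have mZ E j : sub_measurable (particle_system E (pred1 j)) (Z E j).
  rewrite /Z; case: insubP => [i _ <-|_]; first exact: mz.
  exact: measurable_cst.
have -> : ensemble_mean z =
    fun E w => (ens_size E)%:R^-1 * \sum_(j < ens_size E) Z E j w.
  apply/funext => E; apply/funext => w; congr (_ * _).
  by apply: eq_bigr => i _; rewrite ZE.
apply: lln => //.
- exact: ens_size_ge2.
- split=> [[E j] /=|p].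
    rewrite /Z; case: insubP => [i _ _|_]; last exact: measurable_cst.
    exact: (tame_measurable (existT _ E i) tz).
  have [C HC] := tz.2 p; exists (`|C| + 1) => -[E j] /=.
  rewrite /Z; case: insubP => [i _ _|_].
    rewrite (le_trans (HC (existT _ E i)))// lee_fin.
    by rewrite (le_trans (ler_norm _))// lerDl.
  rewrite /abs_moment integral_cst//= probability_setT mule1 lee_fin normr0.
  by rewrite expr0n; case: (p == _); rewrite ?lerDr ?addr_ge0.
- by move=> E j jN; rewrite (ZE E (Ordinal jN)) Ez.
- move=> E k kN.
  apply: (@particle_indep E (fun j => (j < k)%N) (pred1 k)) => //.
    by move=> n /= nk; rewrite neq_ltn nk.
  apply: measurable_sum => j.
  by apply: (@particle_system_mono E (pred1 (val j))) => // n /= /eqP ->.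
Qed.

Variable l : nat.

(** The coordinates of the initial state, then those of the signal and observation
    noise increments over grid step k. *)
Definition coord : Type := 'I_dx + (nat * 'I_dx + nat * 'I_dy).

Definition noise (c : coord) (E : ensemble) (i : 'I_(ens_size E)) (w : T) : R :=
  match c with
  | inl a => ens_init i w a 0
  | inr (inl (k, a)) => incr l (fun s => ens_W i s w) k a 0
  | inr (inr (k, a)) => incr l (fun s => ens_V i s w) k a 0
  end.

Definition noise_mean (c : coord) : R := if c is inl a then mM0 M a 0 else 0.

Definition noise_cov (c c' : coord) : R :=
  match c, c' with
  | inl a, inl b => mP0 M a b
  | inr (inl (k, a)), inr (inl (k', b)) => (k == k')%:R * (step R l)%:M a b
  | inr (inr (k, a)), inr (inr (k', b)) => (k == k')%:R * (step R l)%:M a b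
  | _, _ => 0
  end.

Lemma step_ge0 : 0 <= step R l.
Proof. by rewrite invr_ge0 exprn_ge0. Qed.

Lemma grid_ge0 k : 0 <= k%:R * step R l.
Proof. by rewrite mulr_ge0 ?ler0n ?step_ge0. Qed.

Lemma incr_gaussian n (B : R -> T -> 'cV[R]_n) k : brownian_motion P B ->
  gaussian_vector P 0 (step R l)%:M (fun w => incr l (fun s => B s w) k).
Proof.
move=> hB; have := bm_gaussian hB (grid_ge0 k).
move=> /(_ (k.+1%:R * step R l)).
have -> : k.+1%:R * step R l - k%:R * step R l = step R l.
  by rewrite -natr1; ring.
by apply; rewrite ler_wpM2r ?step_ge0// ler_nat.
Qed.

Lemma incr_indep n (B : R -> T -> 'cV[R]_n) k k' a b : brownian_motion P B ->
  k != k' -> indep_rv P (fun w => incr l (fun s => B s w) k a 0)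
                        (fun w => incr l (fun s => B s w) k' b 0).
Proof.
move=> hB kk'; pose K := (maxn k k').+1.
have kK : (k < K)%N by rewrite ltnS leq_maxl.
have k'K : (k' < K)%N by rewrite ltnS leq_maxr.
pose g (i : 'I_K) := sigma_vector (fun w => incr l (fun s => B s w) i).
have gi : mutually_independent P g.
  apply: (bm_independent hB (t := fun i => i%:R * step R l)).
    exact: grid_ge0.
  by move=> i j ij; rewrite ler_wpM2r ?step_ge0// ler_nat.
have mg (i : 'I_K) : g i `<=` measurable.
  apply: sigma_rvs_measurable => c _.
  exact: gaussian_vector_measurable (incr_gaussian i hB) c.
apply: (@group_indep_rv _ _ _ P _ g mg _ _ gi [set Ordinal kK]%SET [set Ordinal k'K]%SET).
- by move=> i; exact: sigma_rvs_setI.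
- by move=> i; exact: sigma_rvs_setT.
- by move=> i; rewrite !inE => /eqP ->.
- apply: (sub_measurable_union (k := Ordinal kK)); first by rewrite inE.
  exact: (@sub_measurable_sigma_rvs _ _ _ 'I_n setT
    (fun c w => incr l (fun s => B s w) k c 0) a).
- apply: (sub_measurable_union (k := Ordinal k'K)); first by rewrite inE.
  exact: (@sub_measurable_sigma_rvs _ _ _ 'I_n setT
    (fun c w => incr l (fun s => B s w) k' c 0) b).
Qed.

Let noise_label (c : coord) N (i : 'I_N) : label N :=
  match c with
  | inl _ => inr (inl i)
  | inr (inl _) => inr (inr (inl i))
  | inr (inr _) => inr (inr (inr i))
  end.

Let incr_sub_measurable n (B : R -> T -> 'cV[R]_n) k a :
  sub_measurable (sigma_process B) (fun w => incr l (fun s => B s w) k a 0).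
Proof.
have mB t : 0 <= t -> sub_measurable (sigma_process B) (fun w => B t w a 0).
  move=> t0; exact: (@sub_measurable_sigma_rvs _ _ _ (R * 'I_n)%type
    [set p | 0 <= p.1] (fun p w => B p.1 w p.2 0) (t, a)).
under eq_fun do rewrite /incr !mxE.
by apply: measurable_funB; apply: mB; exact: grid_ge0.
Qed.

Let noise_source c E (i : 'I_(ens_size E)) :
  sub_measurable (source (noise_label c i)) (noise c i).
Proof.
case: c => [a|[[k a]|[k a]]] /=; [|exact: incr_sub_measurable..].
exact: (@sub_measurable_sigma_rvs _ _ _ 'I_dx setT (fun a w => ens_init i w a 0)).
Qed.

Lemma noise_sub_measurable c E (i : 'I_(ens_size E)) :
  sub_measurable (particle_system E (pred1 (val i))) (noise c i).
Proof.
apply: (sub_measurable_union (k := noise_label c i)); last exact: noise_source.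
by case: c => [a|[[k a]|[k a]]]; rewrite inE /=.
Qed.

Let noise_law c E (i : 'I_(ens_size E)) : [/\ measurable_fun setT (noise c i),
  0 <= noise_cov c c & forall B, measurable B ->
  P (noise c i @^-1` B) = gaussian_law (noise_mean c) (noise_cov c c) B].
Proof.
have [gx gW gV _] := ens_noise E.
case: c => [a|[[k a]|[k a]]] /=; rewrite ?eqxx ?mul1r.
- split; [exact: gaussian_vector_measurable (gx i) a| |].
    exact: gaussian_vector_var_ge0 (gx i) a.
  by move=> B; exact: (gaussian_vector_entry (gx i)).
- have gI := incr_gaussian k (gW i).
  split; [exact: gaussian_vector_measurable gI a| |].
    exact: gaussian_vector_var_ge0 gI a.
  by move=> B /(gaussian_vector_entry gI a) ->; rewrite mxE.
- have gI := incr_gaussian k (gV i).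
  split; [exact: gaussian_vector_measurable gI a| |].
    exact: gaussian_vector_var_ge0 gI a.
  by move=> B /(gaussian_vector_entry gI a) ->; rewrite mxE.
Qed.

Lemma noise_tame c :
  tame P (fun p : {E & 'I_(ens_size E)} => noise c (projT2 p)).
Proof.
apply: (@tame_gaussian_family _ _ _ _ _ _ (fun=> noise_mean c)
  (fun=> noise_cov c c) `|noise_mean c| (noise_cov c c)) => //.
- by move=> [E i]; case: (noise_law c i).
- by move=> [E i]; case: (noise_law c i).
- by move=> [E i] B; case: (noise_law c i) => _ _; exact.
Qed.

Lemma noise_tame1 c E (i : 'I_(ens_size E)) : tame1 P (noise c i).
Proof. exact: (tame1_of (existT _ E i) (noise_tame c)). Qed.

Lemma Ex_noise c E (i : 'I_(ens_size E)) : Ex P (noise c i) = noise_mean c.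
Proof.
have [mz v0 law] := noise_law c i; exact: gaussian_mean mz v0 law.
Qed.

Let noise_indep_label c c' E (i : 'I_(ens_size E)) :
  noise_label c i != noise_label c' i -> indep_rv P (noise c i) (noise c' i).
Proof.
move=> cc'; apply: (group_indep_rv (@source_measurable E) (@source_setI E)
  (@source_setT E) (@source_indep E) (J1 := [set noise_label c i]%SET)
  (J2 := [set noise_label c' i]%SET)).
- by move=> j; rewrite !inE => /eqP ->.
- by apply: (sub_measurable_union (k := noise_label c i)); rewrite ?inE.
- by apply: (sub_measurable_union (k := noise_label c' i)); rewrite ?inE.
Qed.

Lemma Ex_noise_mul c c' E (i : 'I_(ens_size E)) :
  Ex P (fun w => noise c i w * noise c' i w) =
  noise_cov c c' + noise_mean c * noise_mean c'.
Proof.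
have [gx gW gV _] := ens_noise E.
have indep : indep_rv P (noise c i) (noise c' i) -> noise_cov c c' = 0 ->
  Ex P (fun w => noise c i w * noise c' i w) =
  noise_cov c c' + noise_mean c * noise_mean c'.
  move=> cc' ->; rewrite ExM//; [|exact: noise_tame1..].
  by rewrite !Ex_noise add0r.
have [|] := eqVneq (noise_label c i) (noise_label c' i); last first.
  move=> lcc'; apply: indep; first exact: noise_indep_label.
  by move: lcc'; case: c c' => [a|[[k a]|[k a]]] [b|[[k' b]|[k' b]]] //=; rewrite eqxx.
case: c c' indep => [a|[[k a]|[k a]]] [b|[[k' b]|[k' b]]] //= indep _.
- exact: gaussian_vector_cov (gx i) a b.
- have [kk'|/eqP kk'] := pselect (k = k'); last first.
    by apply: indep; [exact: incr_indep|rewrite (negbTE kk') mul0r].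
  rewrite -kk' eqxx mul1r.
  by rewrite (gaussian_vector_cov (incr_gaussian k (gW i)) a b) !mxE.
- have [kk'|/eqP kk'] := pselect (k = k'); last first.
    by apply: indep; [exact: incr_indep|rewrite (negbTE kk') mul0r].
  rewrite -kk' eqxx mul1r.
  by rewrite (gaussian_vector_cov (incr_gaussian k (gV i)) a b) !mxE.
Qed.

Lemma noise_mean_close c :
  close P ens_size (ensemble_mean (noise c)) (fun _ _ => noise_mean c).
Proof.
apply: particle_lln; [exact: noise_tame|exact: Ex_noise|].
exact: noise_sub_measurable.
Qed.

Lemma noise_product_close c c' :
  close P ens_size (ensemble_mean (fun E i w => noise c i w * noise c' i w))
    (fun _ _ => noise_cov c c' + noise_mean c * noise_mean c').
Proof.
apply: particle_lln; [|exact: Ex_noise_mul|].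
  by apply: tameM; exact: noise_tame.
by move=> E i; apply: measurable_funM; exact: noise_sub_measurable.
Qed.

Lemma noise_covariance_close c c' :
  close P ens_size
    (fun E w => ((ens_size E)%:R - 1)^-1 * \sum_(i < ens_size E)
      (noise c i w - ensemble_mean (noise c) E w) *
      (noise c' i w - ensemble_mean (noise c') E w))
    (fun _ _ => noise_cov c c').
Proof.
pose ext c0 E j w := if insub j is Some i then @noise c0 E i w else 0.
have extE c0 E (i : 'I_(ens_size E)) : ext c0 E i = noise c0 i.
  by apply/funext => w; rewrite /ext valK.
have avgE c0 : (fun E w => (ens_size E)%:R^-1 *
    \sum_(j < ens_size E) ext c0 E j w) = ensemble_mean (noise c0).
  apply/funext => E; apply/funext => w; congr (_ * _).
  by apply: eq_bigr => i _; rewrite extE.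
have avgM : (fun E w => (ens_size E)%:R^-1 *
      \sum_(j < ens_size E) ext c E j w * ext c' E j w) =
    ensemble_mean (fun E i w => noise c i w * noise c' i w).
  apply/funext => E; apply/funext => w; congr (_ * _).
  by apply: eq_bigr => i _; rewrite !extE.
have := close_sample_covariance ens_size_ge2 (x := ext c) (y := ext c')
  (P := P) (mx := noise_mean c) (my := noise_mean c')
  (mxy := noise_cov c c' + noise_mean c * noise_mean c').
rewrite /= !avgE avgM.
move=> /(_ (noise_mean_close c) (noise_mean_close c') (noise_product_close c c')).
congr close; apply/funext => E; apply/funext => w; last by rewrite addrK.
congr (_ * _); apply: eq_bigr => i _.
by rewrite !extE -(congr1 (fun f => f E w) (avgE c)) -(congr1 (fun f => f E w) (avgE c')).
Qed.

End ensemble.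

(** * Riemann sums and elementary inequalities *)

Section riemann_sums.
Context {R : realType}.
Local Notation mu := (@lebesgue_measure R).
Implicit Types (f : R -> R) (a b tau : R).

(** Heine's theorem with tolerance 1: a fixed error in the Riemann sums is enough for
    moment bounds. *)
Lemma within_uniformly_continuous f tau :
  {within `[0, tau], continuous f} ->
  \forall m \near \oo, forall x y, x \in `[0, tau] -> y \in `[0, tau] ->
    `|x - y| <= tau / m%:R -> `|f x - f y| <= 1.
Proof.
move=> /subspace_continuousP cf.
have cov := (near_covering_withinP _).2
  ((compact_near_coveringP _).1 (@segment_compact R 0 tau)).
pose close_values (m : nat) x := forall y, y \in `[0, tau] ->
  `|x - y| <= tau / m%:R -> `|f x - f y| <= 1.
have : \forall m \near \oo, `[0, tau]%classic `<=` close_values m.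
  apply: cov => x xI.
  have /cvgrPdist_lt/(_ 2^-1) := cf x xI.
  rewrite invr_gt0 ltr0n => /(_ isT); rewrite near_withinE.
  move=> /nbhs_ballP[eta /= eta0 heta].
  have eta2 : 0 < eta / 2 by rewrite divr_gt0.
  near=> x' m => x'I y yI xy.
  have x'x : `|x - x'| < eta / 2.
    by near: x'; exact: nbhsx_ballx.
  have tm : tau / m%:R < eta / 2.
    have m0 : 0 < m%:R :> R by near: m; exact: nbhs_infty_gtr.
    rewrite ltr_pdivrMr// mulrC -ltr_pdivrMr//.
    by near: m; exact: nbhs_infty_gtr.
  have := heta x'; rewrite /ball /= => /(_ _ x'I) h1.
  have := heta y; rewrite /ball /= => /(_ _ yI) h2.
  have /h1 {}h1 : `|x - x'| < eta by lra.
  have /h2 {}h2 : `|x - y| < eta.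
    by have := ler_distD x' x y; lra.
  by have := ler_distD (f x) (f x') (f y); rewrite (distrC (f x') (f x)); lra.
by apply: filterS => m h x y xI yI; exact: h.
Unshelve. all: by end_near. Qed.

Lemma Rintegral_cst_dist f a b (c : R) : a <= b ->
  mu.-integrable `]a, b] (EFin \o f) ->
  (forall x, x \in `]a, b] -> `|f x - c| <= 1) ->
  `|\int[mu]_(x in `]a, b]) f x - (b - a) * c| <= b - a.
Proof.
move=> ab fi fc.
have muab : mu `]a, b]%classic = (b - a)%:E.
  rewrite lebesgue_measure_itv/= lte_fin; case: ltP => // ba.
  have -> : a = b by apply/eqP; rewrite eq_le ab ba.
  by rewrite subrr.
have ic k : mu.-integrable `]a, b] (EFin \o (fun=> k)).
  apply/integrableP; split; first exact: measurable_cst.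
  by rewrite integral_cst//= muab -EFinM ltry.
have int_cst k : \int[mu]_(x in `]a, b]) (fun=> k) x = (b - a) * k.
  by rewrite Rintegral_cst//= muab mulrC.
rewrite -int_cst -RintegralB//.
have ifc : mu.-integrable `]a, b] (EFin \o (fun x => f x - c)).
  by rewrite (_ : _ \o _ = (EFin \o f) \- (EFin \o (fun=> c)))%E//; exact: integrableB.
apply: (le_trans (le_normr_Rintegral _ ifc)) => //.
rewrite -[X in _ <= X]mulr1 -int_cst; apply: le_Rintegral => //.
by move/integrable_norm : ifc.
Qed.

(** Each cell contributes at most its length to the error. *)
Lemma riemann_sum_dist f tau : 0 <= tau ->
  {within `[0, tau], continuous f} ->
  \forall m \near \oo, forall j, (j <= m)%N ->
    `|\int[mu]_(x in `[0, j%:R * (tau / m%:R)]) f x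
      - tau / m%:R * \sum_(k < j) f (k%:R * (tau / m%:R))| <= tau.
Proof.
move=> tau0 cf; near=> m => j jm.
have m0 : 0 < m%:R :> R by near: m; exact: nbhs_infty_gtr.
have unif : forall x y, x \in `[0, tau] -> y \in `[0, tau] ->
    `|x - y| <= tau / m%:R -> `|f x - f y| <= 1.
  by near: m; exact: within_uniformly_continuous.
set dl := tau / m%:R in unif *; have dl0 : 0 <= dl by rewrite divr_ge0// ltW.
have dlm : dl * m%:R = tau by rewrite /dl divfK// gt_eqF.
have sj k : (k <= m)%N -> k%:R * dl <= tau.
  by move=> km; rewrite -dlm mulrC ler_wpM2l// ler_nat.
have fint : mu.-integrable `[0, tau] (EFin \o f).
  exact: (continuous_compact_integrable (@segment_compact R 0 tau) cf).
have fintS b : b <= tau -> mu.-integrable `[0, b] (EFin \o f).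
  move=> btau; apply: integrableS fint => //; apply: subset_itvl.
  by rewrite bnd_simp.
apply: (@le_trans _ _ (j%:R * dl)); last exact: sj.
elim: j jm => [|j IH] jm.
  by rewrite !mul0r set_itv1 Rintegral_set1 big_ord0 mulr0 subrr normr0.
have {}IH := IH (ltnW jm).
have jj1 : j%:R * dl <= j.+1%:R * dl by rewrite ler_wpM2r// ler_nat.
have j0 : 0 <= j%:R * dl by rewrite mulr_ge0.
have := @Rintegral_itvB R f (BLeft 0) (BRight (j.+1%:R * dl)) (j%:R * dl)
  (fintS _ (sj _ jm)).
rewrite !bnd_simp => /(_ j0 jj1) split_int.
have loc := @Rintegral_cst_dist f (j%:R * dl) (j.+1%:R * dl) (f (j%:R * dl)) jj1.
have jdl : j.+1%:R * dl - j%:R * dl = dl by rewrite -natr1; ring.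
rewrite jdl in loc; rewrite big_ord_recr/= mulrDr.
rewrite -[X in X - _](subrK (\int[mu]_(x in `[0, j%:R * dl]) f x)) split_int.
set I1 := \int[mu]_(x in `]_, _]) _ in loc *.
set I0 := \int[mu]_(x in `[0, _]) _ in IH *.
set S := dl * _ in IH *; set F := dl * f _ in loc *.
have -> : I1 + I0 - (S + F) = (I0 - S) + (I1 - F) by ring.
rewrite (le_trans (ler_normD _ _))// -natr1 mulrDl mul1r lerD//.
apply: loc => [|x].
  apply: integrableS (fintS _ (sj _ jm)) => //; apply: subset_itvr.
  by rewrite bnd_simp.
rewrite in_itv /= => /andP[jx xj1]; apply: unif.
- by rewrite in_itv /= (le_trans j0 (ltW jx)) (le_trans xj1)// sj.
- by rewrite in_itv /= j0 sj// ltnW.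
- rewrite ger0_norm; last by rewrite subr_ge0 ltW.
  by rewrite -[leRHS]jdl lerD2r.
Unshelve. all: by end_near. Qed.

End riemann_sums.

Section elementary_inequalities.
Context {R : realType}.

Lemma discrete_gronwall (a dl : R) (phi g : nat -> R) m : 0 <= a -> 0 <= dl ->
  (forall k, 0 <= phi k) -> (forall k, 0 <= g k) ->
  (forall j, (j < m)%N -> phi j <= g j + a * (dl * \sum_(k < j) phi k)) ->
  dl * \sum_(k < m) phi k <= expR (m%:R * (a * dl)) * (dl * \sum_(k < m) g k).
Proof.
move=> a0 dl0 phi0 g0; elim: m => [|m IH] H; first by rewrite !big_ord0 !mulr0.
have {}IH := IH (fun j jm => H j (leqW jm)).
have adl0 : 0 <= a * dl by rewrite mulr_ge0.
rewrite !big_ord_recr/= !mulrDr -natr1 mulrDl mul1r expRD.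
set S := dl * \sum_(k < m) phi k in IH *.
set G := dl * \sum_(k < m) g k in IH *.
set e := expR (m%:R * _) in IH *.
have S0 : 0 <= S by rewrite mulr_ge0// sumr_ge0.
have e1 : 1 <= e by rewrite -expR0 ler_expR mulr_ge0.
have e2 : 1 + a * dl <= expR (a * dl) by exact: expR_ge1Dx.
have e21 : 1 <= expR (a * dl) by rewrite (le_trans _ e2)// lerDl.
apply: (@le_trans _ _ ((1 + a * dl) * S + dl * g m)).
  have := ler_wpM2l dl0 (H m (ltnSn m)); rewrite -/S; lra.
rewrite lerD//.
  rewrite [e * _]mulrC -mulrA; apply: ler_pM => //; rewrite addr_ge0//.
rewrite ler_peMl ?mulr_ge0// -[1]mul1r ler_pM//.
Qed.

Lemma expn_tangent (x a : R) n : 0 <= x -> 0 <= a ->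
  a ^+ n.+1 + n.+1%:R * a ^+ n * (x - a) <= x ^+ n.+1.
Proof.
move=> x0 a0; elim: n => [|n IH]; first by rewrite !expr1 expr0; lra.
rewrite [leRHS]exprS; apply: le_trans (ler_wpM2l x0 IH).
rewrite -subr_ge0.
have -> : x * (a ^+ n.+1 + n.+1%:R * a ^+ n * (x - a)) -
    (a ^+ n.+2 + n.+2%:R * a ^+ n.+1 * (x - a)) =
    n.+1%:R * a ^+ n * (x - a) ^+ 2.
  by rewrite -!natr1 !exprS; ring.
by rewrite mulr_ge0 ?sqr_ge0// mulr_ge0// exprn_ge0.
Qed.

(** Jensen's inequality for x ^ p: sum the tangent inequality at the mean. *)
Lemma power_mean (m p : nat) (y : nat -> R) : (0 < m)%N ->
  (forall k, 0 <= y k) ->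
  (m%:R^-1 * \sum_(k < m) y k) ^+ p <= m%:R^-1 * \sum_(k < m) y k ^+ p.
Proof.
move=> m0 y0; have mR : m%:R != 0 :> R by rewrite pnatr_eq0 -lt0n.
case: p => [|p].
  by rewrite expr0 sumr_const card_ord mulVf.
set a := m%:R^-1 * _.
have a0 : 0 <= a by rewrite mulr_ge0 ?invr_ge0 ?ler0n ?sumr_ge0.
rewrite -[leLHS](mulKf mR) ler_wpM2l ?invr_ge0 ?ler0n//.
apply: (@le_trans _ _ (\sum_(k < m) (a ^+ p.+1 + p.+1%:R * a ^+ p * (y k - a)))).
  have Sy : \sum_(k < m) y k = m%:R * a by rewrite /a mulVKf.
  rewrite big_split/= -mulr_sumr sumrB !sumr_const card_ord Sy.
  by rewrite -[a *+ m]mulr_natl subrr mulr0 addr0 -[a ^+ _ *+ m]mulr_natl.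
by apply: ler_sum => k _; exact: expn_tangent.
Qed.

End elementary_inequalities.

(** * Moments of the observation process *)

Section moment_limits.
Context (d : measure_display) (T : measurableType d) (R : realType).
Variable P : probability T R.

(** By [power_mean] the moments of an average are at most those of its terms,
    uniformly in the number of terms. *)
Lemma tame_average (Y : nat -> nat -> T -> R) :
  tame P (fun mk : nat * nat => Y mk.1 mk.2) -> (forall m k w, 0 <= Y m k w) ->
  tame P (fun m w => m%:R^-1 * \sum_(k < m) Y m k w).
Proof.
move=> tY Y0.
have tY1 m k : tame1 P (Y m k) by exact: (tame1_of (m, k) tY).
have tA m : tame1 P (fun w => m%:R^-1 * \sum_(k < m) Y m k w).
  by apply/tame1Z/(@tame1_sum _ _ _ P _ _ (fun (k : 'I_m) => Y m k)).
apply: tame_of_even_moments => // p.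
have [C HC] := tame_Ex p.*2 tY; exists (`|C| + 1) => m.
have [->|m0] := posnP m.
  rewrite (@eq_Ex _ _ _ P _ (fun=> 0 ^+ p.*2)) => [|w]; last first.
    by rewrite invr0 mul0r.
  by rewrite Ex_cst expr0n; case: (p.*2 == _); rewrite ?lerDr ?addr_ge0.
have tYp k : tame1 P (fun w => Y m k w ^+ p.*2) by exact: tame1X.
have tS j : tame1 P (fun w => \sum_(k < j) Y m k w ^+ p.*2).
  by apply: (@tame1_sum _ _ _ P _ _ (fun (k : 'I_j) w => Y m k w ^+ p.*2)).
apply: (@le_trans _ _ (Ex P (fun w => m%:R^-1 * \sum_(k < m) Y m k w ^+ p.*2))).
  apply: Ex_le; [exact: tame1X|exact: tame1Z|move=> w].
  by apply: (@power_mean _ _ _ (fun k => Y m k w)).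
rewrite ExZ// ler_pdivrMl ?ltr0n//.
have : forall j, Ex P (fun w => \sum_(k < j) Y m k w ^+ p.*2) <= j%:R * C.
  elim=> [|j IH].
    rewrite (@eq_Ex _ _ _ P _ (fun=> 0)) => [|w]; last by rewrite big_ord0.
    by rewrite Ex_cst mul0r.
  rewrite (@eq_Ex _ _ _ P _ (fun w => \sum_(k < j) Y m k w ^+ p.*2 +
    Y m j w ^+ p.*2)) => [|w]; last by rewrite big_ord_recr.
  rewrite ExD// -natr1 mulrDl mul1r lerD//.
  by have := HC (m, j); under eq_Ex do rewrite norm_expn_double.
move=> /(_ m) /le_trans; apply; rewrite ler_wpM2l//.
by rewrite (le_trans (ler_norm _))// lerDl.
Qed.

Lemma limn_einf_ge (u : nat -> \bar R) (c : \bar R) :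
  (\forall m \near \oo, (c <= u m)%E) -> (c <= limn_einf u)%E.
Proof.
move=> [m0 _ cu]; rewrite limn_einf_lim; apply: lime_ge; first exact: is_cvg_einfs.
exists m0 => // n /= mn; apply: le_ereal_inf_tmp => _ [k /= nk <-].
by apply: cu => /=; exact: leq_trans nk.
Qed.

Lemma limn_einf_le (u : nat -> \bar R) (c : \bar R) :
  (forall m, (u m <= c)%E) -> (limn_einf u <= c)%E.
Proof.
move=> uc; rewrite limn_einf_lim; apply: lime_le; first exact: is_cvg_einfs.
apply: nearW => n; apply: le_trans (uc n).
by apply: ereal_inf_lbound; exists n => /=.
Qed.

(** Fatou's lemma for |h m| ^ p. *)
Lemma tame1_of_eventually_le (f : T -> R) (h : nat -> T -> R) :
  measurable_fun setT f -> tame P h ->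
  {ae P, forall w, \forall m \near \oo, `|f w| <= `|h m w|} -> tame1 P f.
Proof.
move=> mf [mh th] fh; split=> [[]//|p]; have [C hC] := th p; exists C => -[].
have mhp m : measurable_fun setT (EFin \o (fun w => `|h m w| ^+ p)).
  exact/measurable_EFinP/measurable_abs_expn.
apply: (@le_trans _ _ (\int[P]_w limn_einf (fun m => (`|h m w| ^+ p)%:E))%E).
  apply: ae_ge0_le_integral => //.
  - exact/measurable_EFinP/measurable_abs_expn.
  - move=> w _; apply: limn_einf_ge; apply: nearW => m.
    by rewrite lee_fin exprn_ge0.
  - apply: (emeasurable_fun_cvg
      (fun n w => einfs (fun m => (`|h m w| ^+ p)%:E) n)).
      exact: measurable_fun_einfs.
    by move=> w _; rewrite limn_einf_lim; exact: is_cvg_einfs.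
  - apply: filterS fh => w fhw _; apply: limn_einf_ge.
    apply: filterS fhw => m fm.
    by rewrite lee_fin lerXn2r ?nnegrE.
apply: le_trans (fatou _ _ _ _) _ => //.
exact: limn_einf_le.
Qed.

End moment_limits.

Section norms.
Context {R : realType}.

Lemma linear_form_continuous n (c : 'I_n -> R) (s : seq 'I_n) :
  continuous (fun v : 'cV[R]_n => \sum_(j <- s) c j * v j 0).
Proof.
elim: s => [|j s IH].
  by under eq_fun do rewrite big_nil; exact: cst_continuous.
under eq_fun do rewrite big_cons.
have cj : continuous (fun v : 'cV[R]_n => c j * v j 0).
  move=> v; apply: (@continuous_comp _ _ _ (fun v : 'cV[R]_n => v j 0) ( *%R (c j))).
    exact: coord_continuous.
  exact: mulrl_continuous.
move=> v; exact: (cvgD (cj v) (IH v)).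
Qed.

(** The l^1 norm, because the equations are estimated entry by entry and summed. *)
Definition norm1 n (x : 'cV[R]_n) : R := \sum_(i < n) `|x i 0|.

Definition entry_sum m n (B : 'M[R]_(m, n)) : R := \sum_i \sum_j `|B i j|.

Lemma norm1_ge0 n (x : 'cV[R]_n) : 0 <= norm1 x.
Proof. exact: sumr_ge0. Qed.

Lemma entry_sum_ge0 m n (B : 'M[R]_(m, n)) : 0 <= entry_sum B.
Proof. by apply: sumr_ge0 => i _; exact: sumr_ge0. Qed.

Lemma norm1_mul m n (B : 'M[R]_(m, n)) (x : 'cV[R]_n) :
  norm1 (B *m x) <= entry_sum B * norm1 x.
Proof.
rewrite /entry_sum mulr_suml; apply: ler_sum => i _.
rewrite mulr_suml mxE (le_trans (ler_norm_sum _ _ _))//; apply: ler_sum => j _.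
rewrite normrM ler_wpM2l// /norm1 (bigD1 j)//= lerDl.
exact: sumr_ge0.
Qed.

Lemma entry_le_norm1 n (x : 'cV[R]_n) i : `|x i 0| <= norm1 x.
Proof. by rewrite /norm1 (bigD1 i)//= lerDl; exact: sumr_ge0. Qed.

Lemma norm1D n (x y : 'cV[R]_n) : norm1 (x + y) <= norm1 x + norm1 y.
Proof.
by rewrite /norm1 -big_split; apply: ler_sum => i _; rewrite mxE ler_normD.
Qed.

Lemma norm1_sum n I (s : seq I) (x : I -> 'cV[R]_n) :
  norm1 (\sum_(k <- s) x k) <= \sum_(k <- s) norm1 (x k).
Proof.
elim: s => [|k s IH].
  by rewrite !big_nil /norm1 big1// => i _; rewrite mxE normr0.
by rewrite !big_cons (le_trans (norm1D _ _))// lerD2l.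
Qed.

Lemma norm1Z n c (x : 'cV[R]_n) : norm1 (c *: x) = `|c| * norm1 x.
Proof. by rewrite /norm1 mulr_sumr; apply: eq_bigr => i _; rewrite mxE normrM. Qed.

End norms.

Section observation_moments.
Context (R : realType) (dx dy : nat) (M : model R dx dy).
Context (d : measure_display) (T : measurableType d) (P : probability T R).
Variables (V : R -> T -> 'cV[R]_dy) (W : R -> T -> 'cV[R]_dx).
Variables (Y : R -> T -> 'cV[R]_dy) (X : R -> T -> 'cV[R]_dx).
Hypothesis hYX : signal_observation M P V W Y X.

Let a := entry_sum (mA M).

(** The minimum only matters for k > m; it keeps every grid time in [0, tau], so the
   whole array is tame. *)
Let grid tau m k : R := Num.min tau (k%:R * (tau / m%:R)).

Let grid_bounds tau m k : 0 <= tau -> 0 <= grid tau m k <= tau.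
Proof.
move=> tau0; rewrite /grid le_min tau0 ge_min lexx/= andbT.
by rewrite mulr_ge0// divr_ge0.
Qed.

Let noise_increment_tame I (s : I -> R) (b : R) (j : 'I_(dy + dx)) :
  (forall i, 0 <= s i <= b) ->
  tame P (fun i w => (col_mx (V (s i) w) (W (s i) w) -
                      col_mx (V 0 w) (W 0 w)) j 0).
Proof.
move=> sb.
have g i : gaussian_vector P 0 ((s i - 0)%:M) (fun w =>
    col_mx (V (s i) w) (W (s i) w) - col_mx (V 0 w) (W 0 w)).
  by apply: (bm_gaussian (so_noise hYX)) => //; case/andP: (sb i).
apply: (@tame_gaussian_family _ _ _ _ _ _ (fun=> 0) s 0 b).
- by move=> i; exact: gaussian_vector_measurable (g i) j.
- by move=> i; rewrite normr0.
- by move=> i; case/andP: (sb i).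
- by move=> i; case/andP: (sb i).
- move=> i B mB; rewrite (gaussian_vector_entry (g i) j mB).
  by rewrite !mxE eqxx mulr1n subr0.
Qed.

Let Vnorm_tame I (s : I -> R) (b : R) : (forall i, 0 <= s i <= b) ->
  tame P (fun i w => norm1 (V (s i) w - V 0 w)).
Proof.
move=> sb; apply: tame_sum => j; apply: tame_norm.
have := noise_increment_tame (lshift dx j) sb; congr (tame _ _).
apply/funext => i; apply/funext => w.
by rewrite !mxE !(unsplitK (inl j)).
Qed.

Let Wnorm_tame I (s : I -> R) (b : R) : (forall i, 0 <= s i <= b) ->
  tame P (fun i w => norm1 (W (s i) w - W 0 w)).
Proof.
move=> sb; apply: tame_sum => j; apply: tame_norm.
have := noise_increment_tame (rshift dy j) sb; congr (tame _ _).
apply/funext => i; apply/funext => w.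
by rewrite !mxE !(unsplitK (inr j)).
Qed.

(** The part of the Gronwall inequality for norm1 (X t) that does not involve X;
   dx * tau is the total error of the Riemann sums in the dx coordinates. *)
Let forcing tau m k w : R :=
  norm1 (X 0 w) + dx%:R * tau
  + entry_sum (mQhalf M) * norm1 (W (grid tau m k) w - W 0 w).

Let forcing_ge0 tau m k w : 0 <= tau -> 0 <= forcing tau m k w.
Proof.
move=> tau0; rewrite !addr_ge0 ?mulr_ge0 ?norm1_ge0 ?entry_sum_ge0//.
Qed.

Let majorant tau m w : R := tau + entry_sum (mC M) *
    (expR (tau * a) * (tau * (m%:R^-1 * \sum_(k < m) forcing tau m k w)))
  + entry_sum (mRhalf M) * norm1 (V tau w - V 0 w).

Let majorant_tame tau : 0 <= tau -> tame P (majorant tau).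
Proof.
move=> tau0; apply: tameD; last first.
  by apply: tameZ; apply: (Vnorm_tame (s := fun=> tau) (b := tau)) => _; rewrite tau0 lexx.
apply: tameD; first exact: tame_cst.
do 3 apply: tameZ; apply: tame_average; last by move=> m k w; exact: forcing_ge0.
apply: tameD; last first.
  apply: tameZ; apply: (Wnorm_tame (s := fun mk : nat * nat => grid tau mk.1 mk.2)
    (b := tau)) => mk; exact: grid_bounds.
apply: tameD; last exact: tame_cst.
apply: tame_sum => i; apply: tame_norm.
by have := gaussian_vector_tame1 (so_X0_law hYX) i;
  exact: (@tame_reindex _ _ _ _ unit (nat * nat) (fun=> tt)).
Qed.

(** On a fixed path, for m large, the integrals of A X and C X differ from their
   Riemann sums by at most tau per coordinate; the discrete Gronwall inequality then
   bounds the Riemann sum of norm1 X, and hence Y. *)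
Let path_bound tau w (b : 'I_dy) : 0 <= tau ->
  W 0 w = 0 -> V 0 w = 0 -> Y 0 w = 0 ->
  {within [set t : R | 0 <= t], continuous (fun t => X t w)} ->
  (forall t, 0 <= t -> X t w = X 0 w +
     path_integral (fun s => mA M *m X s w) t + mQhalf M *m W t w) ->
  (forall t, 0 <= t -> Y t w = Y 0 w +
     path_integral (fun s => mC M *m X s w) t + mRhalf M *m V t w) ->
  \forall m \near \oo, `|Y tau w b 0| <= `|majorant tau m w|.
Proof.
move=> tau0 W0 V0 Y0 cX eqX eqY.
have cBX n (B : 'M[R]_(n, dx)) i :
    {within `[0, tau], continuous (fun t => (B *m X t w) i 0)}.
  have -> : (fun t => (B *m X t w) i 0) = (fun v : 'cV[R]_dx => (B *m v) i 0) \o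
      (fun t => X t w) by [].
  have cg : continuous (fun v : 'cV[R]_dx => (B *m v) i 0).
    under eq_fun do rewrite mxE.
    exact: linear_form_continuous.
  apply: (@continuous_subspaceW _ _ _ [set t : R | 0 <= t]).
    by move=> x /=; rewrite in_itv /= => /andP[].
  move=> x; apply: (@continuous_comp (subspace [set t : R | 0 <= t]) _ _
    (fun t => X t w) (fun v : 'cV[R]_dx => (B *m v) i 0) x); last exact: cg.
  exact: cX.
near=> m.
have m0 : 0 < m%:R :> R by near: m; exact: nbhs_infty_gtr.
pose dl := tau / m%:R.
have dl0 : 0 <= dl by rewrite divr_ge0// ltW.
have mdl : m%:R * dl = tau by rewrite mulrC divfK// gt_eqF.
have sumA : forall i, forall j, (j <= m)%N ->
    `|\int[lebesgue_measure]_(x in `[0, j%:R * (tau / m%:R)]) (mA M *m X x w) i 0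
      - tau / m%:R * \sum_(k < j) (mA M *m X (k%:R * (tau / m%:R)) w) i 0| <= tau.
  near: m; apply: filter_forall => i.
  exact: (riemann_sum_dist tau0 (cBX _ _ i)).
have sumC : forall j, (j <= m)%N ->
    `|\int[lebesgue_measure]_(x in `[0, j%:R * (tau / m%:R)]) (mC M *m X x w) b 0
      - tau / m%:R * \sum_(k < j) (mC M *m X (k%:R * (tau / m%:R)) w) b 0| <= tau.
  by near: m; exact: (riemann_sum_dist tau0 (cBX _ _ b)).
rewrite -/dl in sumA sumC.
have triangle (x y : R) : `|x - y| <= tau -> `|x| <= tau + `|y|.
  by have := ler_normB x y; have := ler_distD 0 x y; have := ler_distD y x 0;
    rewrite !subr0; lra.
pose phi k := norm1 (X (k%:R * dl) w).
have riemann_norm n (B : 'M[R]_(n, dx)) j :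
    norm1 (dl *: \sum_(k < j) B *m X (k%:R * dl) w) <=
    entry_sum B * (dl * \sum_(k < j) phi k).
  rewrite norm1Z ger0_norm// mulrCA ler_wpM2l// (le_trans (norm1_sum _ _))//.
  by rewrite mulr_sumr; apply: ler_sum => k _; exact: norm1_mul.
have riemann_entry n (B : 'M[R]_(n, dx)) j i :
    (dl *: \sum_(k < j) B *m X (k%:R * dl) w) i 0 =
    dl * \sum_(k < j) (B *m X (k%:R * dl) w) i 0.
  by rewrite mxE summxE.
have gridE k : (k <= m)%N -> grid tau m k = k%:R * dl.
  move=> km; rewrite /grid -/dl; apply/min_idPr.
  by rewrite -[leRHS]mdl ler_wpM2r// ler_nat.
have phi_step j : (j < m)%N ->
    phi j <= forcing tau m j w + a * (dl * \sum_(k < j) phi k).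
  move=> jm; have sj0 : 0 <= j%:R * dl by rewrite mulr_ge0.
  rewrite /phi (eqX _ sj0).
  apply: (le_trans (norm1D _ _)); apply: (le_trans (lerD (norm1D _ _) (norm1_mul _ _))).
  rewrite /forcing gridE ?(ltnW jm)// W0 subr0.
  set q := entry_sum _ * _; set x0 := norm1 (X 0 w).
  suff : norm1 (path_integral (fun s => mA M *m X s w) (j%:R * dl)) <=
      dx%:R * tau + a * (dl * \sum_(k < j) phi k) by lra.
  apply: le_trans (lerD (lexx _) (riemann_norm _ _ _)).
  have -> : dx%:R * tau = \sum_(i < dx) tau by rewrite sumr_const card_ord mulr_natl.
  rewrite /norm1 -big_split/=.
  apply: ler_sum => i _; apply: triangle.
  by rewrite riemann_entry mxE; apply: sumA; exact: ltnW.
have gron : dl * \sum_(k < m) phi k <=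
    expR (tau * a) * (tau * (m%:R^-1 * \sum_(k < m) forcing tau m k w)).
  have := @discrete_gronwall R a dl phi (fun k => forcing tau m k w) m
    (entry_sum_ge0 _) dl0 (fun k => norm1_ge0 _)
    (fun k => forcing_ge0 m k w tau0) phi_step.
  by rewrite (mulrCA m%:R) mdl [a * tau]mulrC (mulrA tau).
apply: le_trans (ler_norm _); rewrite /majorant V0 subr0.
rewrite eqY// Y0 add0r mxE (le_trans (ler_normD _ _))// lerD//; last first.
  by apply: (le_trans (entry_le_norm1 _ _)); exact: norm1_mul.
rewrite -[X in path_integral _ X]mdl mxE.
apply: (le_trans (triangle _ _ (sumC _ (leqnn m)))); rewrite lerD2l.
rewrite -riemann_entry (le_trans (entry_le_norm1 _ _))//.
by rewrite (le_trans (riemann_norm _ _ _))// ler_wpM2l ?entry_sum_ge0.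
Unshelve. all: by end_near. Qed.

Lemma observation_tame1 tau b : 0 <= tau -> tame1 P (fun w => Y tau w b 0).
Proof.
move=> tau0.
apply: (@tame1_of_eventually_le _ _ _ _ _ (majorant tau)).
- exact: so_Y_random hYX _ tau0 b.
- exact: majorant_tame.
- have := so_X_continuous hYX; have := so_Y0 hYX; have := so_X_eq hYX.
  have := so_Y_eq hYX; have := bm_start (so_noise hYX).
  move=> hVW0 heqY heqX hY0 hcX.
  near=> w.
  have VW0 : col_mx (V 0 w) (W 0 w) = 0 by near: w.
  have eqY : forall t, 0 <= t -> Y t w = Y 0 w +
     path_integral (fun s => mC M *m X s w) t + mRhalf M *m V t w by near: w.
  have eqX : forall t, 0 <= t -> X t w = X 0 w +
     path_integral (fun s => mA M *m X s w) t + mQhalf M *m W t w by near: w.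
  have Y0 : Y 0 w = 0 by near: w.
  have cX : {within [set t : R | 0 <= t], continuous (fun t => X t w)}.
    by near: w.
  have V0 : V 0 w = 0.
    by have := congr1 usubmx VW0; rewrite col_mxKu linear0.
  have W0 : W 0 w = 0.
    by have := congr1 dsubmx VW0; rewrite col_mxKd linear0.
  exact: path_bound.
Unshelve. all: by end_near. Qed.

End observation_moments.

(** * Algebra of sample covariances and of one filter step *)

Section sample_covariance.
Context {R : realType}.

Definition sample_xcov N m n (x : 'I_N -> 'cV[R]_m) (y : 'I_N -> 'cV[R]_n) :
    'M[R]_(m, n) :=
  (N%:R - 1)^-1 *: \sum_(i < N) (x i - sample_mean x) *m (y i - sample_mean y)^T.

Lemma sample_meanD N n (x y : 'I_N -> 'cV[R]_n) :
  sample_mean (fun i => x i + y i) = sample_mean x + sample_mean y.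
Proof. by rewrite /sample_mean big_split scalerDr. Qed.

Lemma sample_meanM N m n (B : 'M[R]_(m, n)) (x : 'I_N -> 'cV[R]_n) :
  sample_mean (fun i => B *m x i) = B *m sample_mean x.
Proof. by rewrite /sample_mean -mulmx_sumr scalemxAr. Qed.

Lemma sample_mean_cst N n (c : 'cV[R]_n) : (0 < N)%N ->
  sample_mean (fun _ : 'I_N => c) = c.
Proof.
move=> N0; rewrite /sample_mean sumr_const card_ord -[c *+ N]scaler_nat scalerA.
by rewrite mulVf ?scale1r// pnatr_eq0 -lt0n.
Qed.

Lemma sample_xcov_tr N m n (x : 'I_N -> 'cV[R]_m) (y : 'I_N -> 'cV[R]_n) :
  (sample_xcov x y)^T = sample_xcov y x.
Proof.
rewrite /sample_xcov linearZ/= linear_sum/=; congr (_ *: _).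
by apply: eq_bigr => i _; rewrite trmx_mul trmxK.
Qed.

Lemma sample_xcovDl N m n (x x' : 'I_N -> 'cV[R]_m) (y : 'I_N -> 'cV[R]_n) :
  sample_xcov (fun i => x i + x' i) y = sample_xcov x y + sample_xcov x' y.
Proof.
rewrite /sample_xcov sample_meanD -[RHS]scalerDr -big_split; congr (_ *: _).
by apply: eq_bigr => i _ /=; rewrite -mulmxDl opprD addrACA.
Qed.

Lemma sample_xcovMl N m n p (B : 'M[R]_(p, m)) (x : 'I_N -> 'cV[R]_m)
    (y : 'I_N -> 'cV[R]_n) :
  sample_xcov (fun i => B *m x i) y = B *m sample_xcov x y.
Proof.
rewrite /sample_xcov sample_meanM -[RHS]scalemxAr mulmx_sumr; congr (_ *: _).
by apply: eq_bigr => i _; rewrite -mulmxBr mulmxA.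
Qed.

Lemma sample_xcov_cst N m n (c : 'cV[R]_m) (y : 'I_N -> 'cV[R]_n) : (0 < N)%N ->
  sample_xcov (fun=> c) y = 0.
Proof.
move=> N0; rewrite /sample_xcov sample_mean_cst// big1 ?scaler0// => i _.
by rewrite subrr mul0mx.
Qed.

Lemma sample_xcov_entry N m n (x : 'I_N -> 'cV[R]_m) (y : 'I_N -> 'cV[R]_n) a b :
  sample_xcov x y a b = (N%:R - 1)^-1 *
    \sum_(i < N) (x i a 0 - N%:R^-1 * \sum_(j < N) x j a 0)
               * (y i b 0 - N%:R^-1 * \sum_(j < N) y j b 0).
Proof.
rewrite !mxE summxE; congr (_ * _); apply: eq_bigr => i _.
by rewrite !mxE big_ord1 !mxE !summxE.
Qed.

End sample_covariance.

Section matrix_closeness.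
Context (d : measure_display) (T : measurableType d) (R : realType).
Variable P : probability T R.
Context (I : Type) (N : I -> nat).

(** Closeness of random matrices, entry by entry. *)
Definition mclose m n (F G : I -> T -> 'M[R]_(m, n)) : Prop :=
  forall a b, close P N (fun i w => F i w a b) (fun i w => G i w a b).

Lemma mclose_cst m n (B : 'M[R]_(m, n)) : mclose (fun _ _ => B) (fun _ _ => B).
Proof. by move=> a b; exact: close_cst. Qed.

Lemma mclose_eq m n (F F' G G' : I -> T -> 'M[R]_(m, n)) :
  mclose F G -> (forall i w, F' i w = F i w) -> (forall i w, G' i w = G i w) ->
  mclose F' G'.
Proof.
move=> FG FF GG; have -> : F' = F by apply/funext => i; apply/funext => w.
by have -> : G' = G by apply/funext => i; apply/funext => w.
Qed.

Lemma mcloseD m n (F G F' G' : I -> T -> 'M[R]_(m, n)) :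
  mclose F G -> mclose F' G' ->
  mclose (fun i w => F i w + F' i w) (fun i w => G i w + G' i w).
Proof.
move=> FG FG' a b; have := closeD (FG a b) (FG' a b).
by congr close; apply/funext => i; apply/funext => w; rewrite mxE.
Qed.

Lemma mcloseZ m n (c : R) (F G : I -> T -> 'M[R]_(m, n)) : mclose F G ->
  mclose (fun i w => c *: F i w) (fun i w => c *: G i w).
Proof.
move=> FG a b; have := closeZ c (FG a b).
by congr close; apply/funext => i; apply/funext => w; rewrite mxE.
Qed.

Lemma mcloseN m n (F G : I -> T -> 'M[R]_(m, n)) : mclose F G ->
  mclose (fun i w => - F i w) (fun i w => - G i w).
Proof.
by move=> FG; apply: (mclose_eq (mcloseZ (-1) FG)) => i w; rewrite scaleN1r.
Qed.

Lemma mclose_tr m n (F G : I -> T -> 'M[R]_(m, n)) : mclose F G ->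
  mclose (fun i w => (F i w)^T) (fun i w => (G i w)^T).
Proof.
move=> FG a b; have := FG b a.
by congr close; apply/funext => i; apply/funext => w; rewrite mxE.
Qed.

Lemma mcloseM m n p (F G : I -> T -> 'M[R]_(m, n)) (F' G' : I -> T -> 'M[R]_(n, p)) :
  mclose F G -> mclose F' G' ->
  mclose (fun i w => F i w *m F' i w) (fun i w => G i w *m G' i w).
Proof.
move=> FG FG' a b.
have := @close_sum _ _ _ P I N _ (index_enum 'I_n)
  _ _ (fun k => closeM (FG a k) (FG' k b)).
by congr close; apply/funext => i; apply/funext => w; rewrite mxE.
Qed.

Lemma close_inner n (F G F' G' : I -> T -> 'cV[R]_n) :
  mclose F G -> mclose F' G' ->
  close P N (fun i w => inner (F i w) (F' i w)) (fun i w => inner (G i w) (G' i w)).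
Proof.
move=> FG FG'.
exact: (@close_sum _ _ _ P I N _ (index_enum 'I_n)
  _ _ (fun k => closeM (FG k 0) (FG' k 0))).
Qed.

End matrix_closeness.

Section filter_recursion.
Context (R : realType) (dx dy : nat) (M : model R dx dy) (l : nat).

Definition gain (G : 'M[R]_dx) : 'M[R]_(dx, dy) :=
  G *m (mC M)^T *m invmx (mR M).

(** The matrix applied to a particle in one step; with the gain it determines the step
    completely, see [enkf_step]. *)
Definition transition (G : 'M[R]_dx) : 'M[R]_dx :=
  1%:M + step R l *: mA M - step R l *: (gain G *m mC M).

Lemma enkf_step N (Y : R -> 'cV[R]_dy) (xi0 : 'I_N -> 'cV[R]_dx)
    (Wb : 'I_N -> R -> 'cV[R]_dx) (Vb : 'I_N -> R -> 'cV[R]_dy) k :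
  let xi := enkf M l Y xi0 Wb Vb in
  let K := gain (sample_cov (xi k)) in
  xi k.+1 = fun i => transition (sample_cov (xi k)) *m xi k i
    + mQhalf M *m incr l (Wb i) k + (- (K *m mRhalf M)) *m incr l (Vb i) k
    + K *m incr l Y k.
Proof.
move=> xi K; apply/funext => i; rewrite /xi /= -/(gain _) -/xi -/K.
have -> : transition (sample_cov (xi k)) *m xi k i =
    xi k i + step R l *: (mA M *m xi k i) - step R l *: (K *m mC M *m xi k i).
  by rewrite /transition mulmxBl mulmxDl mul1mx -!scalemxAl.
have -> u v : K *m (u - (step R l *: (mC M *m xi k i) + v)) =
    K *m u - step R l *: (K *m mC M *m xi k i) - K *m v.
  by rewrite mulmxBr mulmxDr -scalemxAr mulmxA opprD addrA.
clearbody K; rewrite mulNmx -!mulmxA.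
move: (mA M *m _) (K *m (mC M *m _)) (K *m incr l Y k)
  (mQhalf M *m _) (K *m (mRhalf M *m _)) => x2 x3 x4 x5 x6.
by apply/matrixP => p q; rewrite !mxE; ring.
Qed.

Lemma conjugate_step (s : R) (D G D' : 'M[R]_dx) :
  (1%:M + s *: D) *m (G *m (1%:M + s *: D')) =
  G + s *: (D *m G + G *m D') + s ^+ 2 *: (D *m G *m D').
Proof.
rewrite mulmxDl mul1mx !mulmxDr !mulmx1 -!scalemxAr -!scalemxAl !mulmxA.
rewrite scalerA -expr2.
move: (D *m G) (G *m D') (D *m G *m D') => x y z.
by apply/matrixP => i j; rewrite !mxE; ring.
Qed.

Hypothesis P0_sym : (mP0 M)^T = mP0 M.

Lemma mR_sym : (mR M)^T = mR M.
Proof. by rewrite /mR trmx_mul mRhalf_sym. Qed.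

Lemma mR_unit : mR M \in unitmx.
Proof. by rewrite /mR unitmx_mul mRhalf_unit. Qed.

Lemma mS_sym : (mS M)^T = mS M.
Proof. by rewrite /mS !trmx_mul trmxK trmx_inv mR_sym mulmxA. Qed.

Lemma gain_mC G : gain G *m mC M = G *m mS M.
Proof. by rewrite /gain /mS !mulmxA. Qed.

(** The noise fed in through the gain has covariance K R K^T = G S G, which turns the
    -2 G S G coming from the transition matrices into the - G S G of [Ricc]. *)
Lemma gain_noise G : G^T = G ->
  gain G *m mRhalf M *m (gain G *m mRhalf M)^T = G *m mS M *m G.
Proof.
move=> Gs; rewrite /gain !trmx_mul trmxK trmx_inv mR_sym mRhalf_sym Gs.
rewrite !mulmxA -(mulmxA _ (mRhalf M) (mRhalf M)) -/(mR M).
by rewrite (mulmxKV mR_unit).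
Qed.

Lemma transitionE G : transition G = 1%:M + step R l *: (mA M - G *m mS M).
Proof. by rewrite /transition gain_mC scalerBr addrA. Qed.

(** The Riccati step is the covariance of B x + Q^{1/2} dW - K R^{1/2} dV with x of
    covariance G and independent increments.  The transposed products are arranged as
    they arise when the sample covariance is expanded on both sides. *)
Lemma kb_cov_step k : (kb_cov M l k)^T = kb_cov M l k ->
  let G := kb_cov M l k in
  kb_cov M l k.+1 = transition G *m (transition G *m G)^T
    + mQhalf M *m (step R l *: mQhalf M)^T
    + gain G *m mRhalf M *m (step R l *: (gain G *m mRhalf M))^T.
Proof.
move=> Gs G; rewrite /= -/G [in RHS]linearZ/= -scalemxAr mQhalf_sym -/(mQ M).
rewrite [(step R l *: (gain G *m mRhalf M))^T]linearZ/= -scalemxAr gain_noise//.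
rewrite trmx_mul Gs transitionE.
set D := mA M - G *m mS M.
have -> : (1%:M + step R l *: D)^T = 1%:M + step R l *: ((mA M)^T - mS M *m G).
  by rewrite linearD/= trmx1 linearZ/= /D linearB/= trmx_mul mS_sym Gs.
set D' := (mA M)^T - mS M *m G.
have -> : (1%:M + step R l *: D) *m (G *m (1%:M + step R l *: D')) =
    G + step R l *: (D *m G + G *m D') + step R l ^+ 2 *: (D *m G *m D').
  exact: conjugate_step.
have -> : Ricc M G = D *m G + G *m D' + mQ M + G *m mS M *m G.
  rewrite /Ricc /D /D' mulmxBl mulmxBr !mulmxA.
  move: (mA M *m G) (G *m (mA M)^T) (G *m mS M *m G) => u v s.
  by apply/matrixP => i j; rewrite !mxE; ring.
rewrite !scalerDr !addrA.
by apply/matrixP => i j; rewrite !mxE; ring.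
Qed.

Lemma kb_cov_sym k : (kb_cov M l k)^T = kb_cov M l k.
Proof.
elim: k => [//|k IH]; rewrite kb_cov_step// !linearD/=.
congr (_ + _ + _); rewrite trmx_mul trmxK.
- by rewrite trmx_mul IH mulmxA.
- by rewrite linearZ/= -scalemxAl -scalemxAr mQhalf_sym.
- by rewrite linearZ/= -scalemxAl -scalemxAr.
Qed.

End filter_recursion.

(** * Convergence of the particle filter *)

Section filter_convergence.
Context (R : realType) (dx dy : nat) (M : model R dx dy).
Context (d : measure_display) (T : measurableType d) (P : probability T R).
Variables (V : R -> T -> 'cV[R]_dy) (W : R -> T -> 'cV[R]_dx).
Variables (Y : R -> T -> 'cV[R]_dy) (X : R -> T -> 'cV[R]_dx).
Hypothesis hYX : signal_observation M P V W Y X.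
Variable l : nat.

Local Notation ens := (ensemble M P Y X).
Local Notation "F ~~ G" := (mclose P (@ens_size _ _ _ M _ _ P Y X) F G)
  (at level 70, no associativity).

Let W_ (j : nat) (E : ens) w (i : 'I_(ens_size E)) :=
  incr l (fun s => ens_W i s w) j.
Let V_ (j : nat) (E : ens) w (i : 'I_(ens_size E)) :=
  incr l (fun s => ens_V i s w) j.
Let dY (j : nat) (w : T) := incr l (fun s => Y s w) j.
Let xi (k : nat) (E : ens) w : 'I_(ens_size E) -> 'cV[R]_dx :=
  enkf M l (fun s => Y s w) (fun i => ens_init i w)
    (fun i s => ens_W i s w) (fun i s => ens_V i s w) k.

Let cov_close (c c' : coord dx dy) : close P (@ens_size _ _ _ M _ _ P Y X)
  (fun E w => ((ens_size E)%:R - 1)^-1 * \sum_(i < ens_size E)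
    (noise l c i w - ensemble_mean (noise l c) E w) *
    (noise l c' i w - ensemble_mean (noise l c') E w))
  (fun _ _ => noise_cov M l c c').
Proof.
apply: noise_covariance_close; [exact: so_X_random hYX|exact: so_Y_random hYX].
Qed.

Let mean_close (c : coord dx dy) : close P (@ens_size _ _ _ M _ _ P Y X)
  (ensemble_mean (noise l c)) (fun _ _ => noise_mean M c).
Proof.
apply: noise_mean_close; [exact: so_X_random hYX|exact: so_Y_random hYX].
Qed.

Let xcov_noise m n (x : forall (E : ens) (w : T), 'I_(ens_size E) -> 'cV[R]_m)
    (y : forall (E : ens) (w : T), 'I_(ens_size E) -> 'cV[R]_n)
    (cx : 'I_m -> coord dx dy) (cy : 'I_n -> coord dx dy) (S : 'M[R]_(m, n)) :
  (forall a E i w, x E w i a 0 = noise l (cx a) i w) ->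
  (forall a E i w, y E w i a 0 = noise l (cy a) i w) ->
  (forall a b, noise_cov M l (cx a) (cy b) = S a b) ->
  (fun E w => sample_xcov (x E w) (y E w)) ~~ (fun _ _ => S).
Proof.
move=> hx hy hS a b; have := cov_close (cx a) (cy b).
congr close; apply/funext => E; apply/funext => w; last by rewrite hS.
rewrite sample_xcov_entry; congr (_ * _); apply: eq_bigr => i _.
have mE p (z : forall (E : ens) (w : T), 'I_(ens_size E) -> 'cV[R]_p)
    (cz : 'I_p -> coord dx dy) c :
    (forall a E i w, z E w i a 0 = noise l (cz a) i w) ->
    ensemble_mean (noise l (cz c)) E w =
    (ens_size E)%:R^-1 * \sum_(j < ens_size E) z E w j c 0.
  by move=> hz; congr (_ * _); apply: eq_bigr => j _; rewrite hz.
by rewrite (mE _ _ _ _ hx) (mE _ _ _ _ hy) hx hy.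
Qed.

Let mean_noise m (x : forall (E : ens) (w : T), 'I_(ens_size E) -> 'cV[R]_m)
    (cx : 'I_m -> coord dx dy) (mu : 'cV[R]_m) :
  (forall a E i w, x E w i a 0 = noise l (cx a) i w) ->
  (forall a, noise_mean M (cx a) = mu a 0) ->
  (fun E w => sample_mean (x E w)) ~~ (fun _ _ => mu).
Proof.
move=> hx hmu a b; rewrite (ord1 b); have := mean_close (cx a).
congr close; apply/funext => E; apply/funext => w; last by rewrite hmu.
rewrite mxE summxE; congr (_ * _); apply: eq_bigr => i _; by rewrite hx.
Qed.

Let cI (a : 'I_dx) : coord dx dy := inl a.
Let cW j (a : 'I_dx) : coord dx dy := inr (inl (j, a)).
Let cV j (a : 'I_dy) : coord dx dy := inr (inr (j, a)).

Let WW j j' : (fun E w => sample_xcov (@W_ j E w) (@W_ j' E w)) ~~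
  (fun _ _ => (j == j')%:R *: (step R l)%:M).
Proof.
by apply: (xcov_noise (cx := cW j) (cy := cW j')) => // a b; rewrite mxE.
Qed.

Let VV j j' : (fun E w => sample_xcov (@V_ j E w) (@V_ j' E w)) ~~
  (fun _ _ => (j == j')%:R *: (step R l)%:M).
Proof.
by apply: (xcov_noise (cx := cV j) (cy := cV j')) => // a b; rewrite mxE.
Qed.

Let WV j j' : (fun E w => sample_xcov (@W_ j E w) (@V_ j' E w)) ~~ (fun _ _ => 0).
Proof.
by apply: (xcov_noise (cx := cW j) (cy := cV j')) => // a b; rewrite mxE.
Qed.

Let VW j j' : (fun E w => sample_xcov (@V_ j E w) (@W_ j' E w)) ~~ (fun _ _ => 0).
Proof.
by apply: (xcov_noise (cx := cV j) (cy := cW j')) => // a b; rewrite mxE.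
Qed.

Let mean_W j : (fun E w => sample_mean (@W_ j E w)) ~~ (fun _ _ => 0).
Proof. by apply: (mean_noise (cx := cW j)) => // a; rewrite mxE. Qed.

Let mean_V j : (fun E w => sample_mean (@V_ j E w)) ~~ (fun _ _ => 0).
Proof. by apply: (mean_noise (cx := cV j)) => // a; rewrite mxE. Qed.

Let dY_close j : (fun _ w => dY j w) ~~ (fun _ w => dY j w).
Proof.
move=> a b; rewrite (ord1 b); apply: close_refl.
apply: (@tame_reindex _ _ _ _ unit _ (fun=> tt) (fun _ w => dY j w a 0)).
have := tameB (observation_tame1 hYX a (grid_ge0 R l j.+1))
  (observation_tame1 hYX a (grid_ge0 R l j)).
by congr (tame _ _); apply/funext => -[]; apply/funext => w; rewrite !mxE.
Qed.

Let N0 (E : ens) : (0 < ens_size E)%N.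
Proof. by apply: leq_trans (ens_size_ge2 E). Qed.

Let xi_step k (E : ens) w : @xi k.+1 E w =
  fun i : 'I_(ens_size E) => transition M l (sample_cov (@xi k E w)) *m @xi k E w i
    + mQhalf M *m @W_ k E w i
    + (- (gain M (sample_cov (@xi k E w)) *m mRhalf M)) *m @V_ k E w i
    + gain M (sample_cov (@xi k E w)) *m dY k w.
Proof. exact: enkf_step. Qed.

Let xcov_step k n (E : ens) w (z : 'I_(ens_size E) -> 'cV[R]_n) :
  sample_xcov (@xi k.+1 E w) z =
    transition M l (sample_cov (@xi k E w)) *m sample_xcov (@xi k E w) z
    + mQhalf M *m sample_xcov (@W_ k E w) z
    + (- (gain M (sample_cov (@xi k E w)) *m mRhalf M)) *m sample_xcov (@V_ k E w) z.
Proof.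
by rewrite xi_step 3!sample_xcovDl 4!sample_xcovMl sample_xcov_cst// mulmx0 addr0.
Qed.

Let mean_step k (E : ens) w : sample_mean (@xi k.+1 E w) =
    transition M l (sample_cov (@xi k E w)) *m sample_mean (@xi k E w)
    + mQhalf M *m sample_mean (@W_ k E w)
    + (- (gain M (sample_cov (@xi k E w)) *m mRhalf M)) *m sample_mean (@V_ k E w)
    + gain M (sample_cov (@xi k E w)) *m dY k w.
Proof.
by rewrite xi_step 3!sample_meanD 4!sample_meanM sample_mean_cst.
Qed.

Let P0_sym : (mP0 M)^T = mP0 M.
Proof. by case: (so_X0_law hYX) => [[]]. Qed.

Let gain_close F G : (F : ens -> T -> _) ~~ G ->
  (fun E w => gain M (F E w)) ~~ (fun E w => gain M (G E w)).
Proof.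
move=> FG; do 2 (apply: mcloseM; last exact: mclose_cst); exact: FG.
Qed.

Let transition_close F G : (F : ens -> T -> _) ~~ G ->
  (fun E w => transition M l (F E w)) ~~ (fun E w => transition M l (G E w)).
Proof.
move=> FG; apply: mcloseD; first exact: mclose_cst.
apply/mcloseN/mcloseZ/mcloseM; [exact: gain_close|exact: mclose_cst].
Qed.

(** The statements on the noise still to come are part of the induction: at step k they
    give the cross terms in the expansion of the covariance at step k + 1.  Besides them
    the expansion needs the covariances of the new particles with the noise of step k
    itself ([stepW] and [stepV] at j = k) and with the old particles ([kX]). *)
Lemma covariance_close k :
  [/\ (fun E w => sample_cov (@xi k E w)) ~~ (fun _ _ => kb_cov M l k),
      forall j, (k <= j)%N ->
        (fun E w => sample_xcov (@xi k E w) (@W_ j E w)) ~~ (fun _ _ => 0)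
    & forall j, (k <= j)%N ->
        (fun E w => sample_xcov (@xi k E w) (@V_ j E w)) ~~ (fun _ _ => 0)].
Proof.
elim: k => [|k [covk Wk Vk]].
  split=> [|j _|j _].
  - exact: (xcov_noise (cx := cI) (cy := cI)).
  - by apply: (xcov_noise (cx := cI) (cy := cW j)) => // a b; rewrite mxE.
  - by apply: (xcov_noise (cx := cI) (cy := cV j)) => // a b; rewrite mxE.
set G := kb_cov M l k in covk *.
have tk := transition_close covk.
have gk : (fun E w => - (gain M (sample_cov (@xi k E w)) *m mRhalf M)) ~~
    (fun _ _ => - (gain M G *m mRhalf M)).
  by apply/mcloseN/mcloseM; [exact: gain_close|exact: mclose_cst].
have step_close n (z : forall (E : ens) (w : T), 'I_(ens_size E) -> 'cV[R]_n)
    (Sx : 'M[R]_(dx, n)) Sw Sv :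
  (fun E w => sample_xcov (@xi k E w) (z E w)) ~~ (fun _ _ => Sx) ->
  (fun E w => sample_xcov (@W_ k E w) (z E w)) ~~ (fun _ _ => Sw) ->
  (fun E w => sample_xcov (@V_ k E w) (z E w)) ~~ (fun _ _ => Sv) ->
  (fun E w => sample_xcov (@xi k.+1 E w) (z E w)) ~~
  (fun _ _ => transition M l G *m Sx + mQhalf M *m Sw
              + (- (gain M G *m mRhalf M)) *m Sv).
  move=> hx hw hv.
  have := mcloseD (mcloseD (mcloseM tk hx) (mcloseM (mclose_cst _ _ (mQhalf M)) hw))
    (mcloseM gk hv).
  by move/mclose_eq; apply=> // E w; rewrite xcov_step.
have stepW j : (k <= j)%N ->
  (fun E w => sample_xcov (@xi k.+1 E w) (@W_ j E w)) ~~
  (fun _ _ => (k == j)%:R *: (step R l *: mQhalf M)).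
  move=> kj; have := step_close _ _ _ _ _ (Wk _ kj) (WW k j) (VW k j).
  move/mclose_eq; apply=> // E w.
  by rewrite !mulmx0 addr0 add0r -scalemxAr mul_mx_scalar.
have stepV j : (k <= j)%N ->
  (fun E w => sample_xcov (@xi k.+1 E w) (@V_ j E w)) ~~
  (fun _ _ => (k == j)%:R *: (step R l *: - (gain M G *m mRhalf M))).
  move=> kj; have := step_close _ _ _ _ _ (Vk _ kj) (WV k j) (VV k j).
  move/mclose_eq; apply=> // E w.
  by rewrite !mulmx0 !add0r -scalemxAr mul_mx_scalar.
split=> [|j kj|j kj].
- have Wk0 := stepW k (leqnn k); have Vk0 := stepV k (leqnn k).
  have kX : (fun E w => sample_xcov (@xi k.+1 E w) (@xi k E w)) ~~
      (fun _ _ => transition M l G *m G).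
    have Wx := mclose_tr (Wk _ (leqnn k)); have Vx := mclose_tr (Vk _ (leqnn k)).
    have Wx0 : (fun E w => sample_xcov (@W_ k E w) (@xi k E w)) ~~ (fun _ _ => 0).
      by apply: (mclose_eq Wx) => E w; rewrite ?sample_xcov_tr ?trmx0.
    have Vx0 : (fun E w => sample_xcov (@V_ k E w) (@xi k E w)) ~~ (fun _ _ => 0).
      by apply: (mclose_eq Vx) => E w; rewrite ?sample_xcov_tr ?trmx0.
    have := step_close _ _ _ _ _ covk Wx0 Vx0.
    by move/mclose_eq; apply=> // E w; rewrite !mulmx0 !addr0.
  have tr n (x : forall (E : ens) (w : T), 'I_(ens_size E) -> 'cV[R]_dx)
      (y : forall (E : ens) (w : T), 'I_(ens_size E) -> 'cV[R]_n) S :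
    (fun E w => sample_xcov (x E w) (y E w)) ~~ (fun _ _ => S) ->
    (fun E w => sample_xcov (y E w) (x E w)) ~~ (fun _ _ => S^T).
    move=> h; apply: (mclose_eq (mclose_tr h)) => E w //.
    by rewrite sample_xcov_tr.
  have := step_close _ _ _ _ _ (tr _ _ _ _ kX) (tr _ _ _ _ Wk0) (tr _ _ _ _ Vk0).
  move/mclose_eq; apply=> // E w.
  rewrite (kb_cov_step (kb_cov_sym l P0_sym k)) -/G eqxx !scale1r.
  by rewrite scalerN linearN/= mulmxN mulNmx opprK.
- have := stepW j (ltnW kj); rewrite (ltn_eqF kj).
  by move/mclose_eq; apply=> // E w; rewrite scale0r.
- have := stepV j (ltnW kj); rewrite (ltn_eqF kj).
  by move/mclose_eq; apply=> // E w; rewrite scale0r.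
Qed.

(** The averaged noise increments are close to 0, and what remains is the recursion of
    the deterministic filter driven by the same observation increments. *)
Lemma mean_close_kb k :
  (fun E w => sample_mean (@xi k E w)) ~~
  (fun _ w => kb_mean M l (fun s => Y s w) k).
Proof.
elim: k => [|k IH]; first exact: (mean_noise (cx := cI)).
have [covk _ _] := covariance_close k.
have tk := transition_close covk; have gk := gain_close covk.
have gk' := mcloseN (mcloseM gk (mclose_cst P (@ens_size _ _ _ M _ _ P Y X) (mRhalf M))).
have := mcloseD (mcloseD (mcloseD (mcloseM tk IH)
  (mcloseM (mclose_cst _ _ (mQhalf M)) (mean_W k)))
  (mcloseM gk' (mean_V k))) (mcloseM gk (dY_close k)).
move/mclose_eq; apply=> E w; first by rewrite mean_step.
rewrite /= !mulmx0 !addr0 -/(gain M _) mulmxBr -scalemxAr mulmxA.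
rewrite /transition mulmxBl mulmxDl mul1mx -!scalemxAl /dY.
by rewrite -!addrA; congr (_ + (_ + _)); rewrite addrC.
Qed.

(** Each summand is a polynomial in the mean and in the tame observation increments. *)
Lemma log_estimate_close n :
  close P (@ens_size _ _ _ M _ _ P Y X)
    (fun E w => log_estimate M l (fun s => Y s w)
                  (fun k => sample_mean (@xi k E w)) n)
    (fun _ w => log_estimate M l (fun s => Y s w)
                  (kb_mean M l (fun s => Y s w)) n).
Proof.
apply: (@close_sum _ _ _ P ens _ _ (index_enum 'I_n)
  (fun k E w => inner (mC M *m sample_mean (@xi k E w)) (invmx (mR M) *m dY k w) -
     step R l / 2 * inner (sample_mean (@xi k E w)) (mS M *m sample_mean (@xi k E w)))
  (fun k _ w => inner (mC M *m kb_mean M l (fun s => Y s w) k) (invmx (mR M) *m dY k w) -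
     step R l / 2 * inner (kb_mean M l (fun s => Y s w) k)
       (mS M *m kb_mean M l (fun s => Y s w) k))) => k.
have mk := mean_close_kb k.
have cM m p (B : 'M[R]_(m, p)) := mclose_cst P (@ens_size _ _ _ M _ _ P Y X) B.
apply: closeB; last by apply/closeZ/close_inner => //; exact: mcloseM.
apply: close_inner; first exact: mcloseM.
by apply: mcloseM => //; exact: dY_close.
Qed.

End filter_convergence.

(** * The error of the log-likelihood estimator *)

Lemma powR_le_1D_expn (R : realType) (x q : R) (p : nat) :
  0 <= x -> 0 <= q -> q <= p%:R -> x `^ q <= 1 + x ^+ p.
Proof.
move=> x0 q0 qp; have [x1|x1] := leP x 1.
  apply: (@le_trans _ _ 1); last by rewrite lerDl exprn_ge0.
  have -> : 1 = 1 `^ q :> R by rewrite powR1.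
    by apply: ge0_ler_powR; rewrite ?nnegrE.
apply: (@le_trans _ _ (x ^+ p)); last by rewrite lerDr.
by rewrite -powR_mulrn// ler_powR// ltW.
Qed.

Theorem propositionA1 (R : realType) (dx dy : nat)
  (dx_gt0 : (0 < dx)%N) (dy_gt0 : (0 < dy)%N) (M : model R dx dy)
  (d : measure_display) (T : measurableType d) (P : probability T R)
  (V : R -> T -> 'cV[R]_dy) (W : R -> T -> 'cV[R]_dx)
  (Y : R -> T -> 'cV[R]_dy) (X : R -> T -> 'cV[R]_dx)
  (hYX : signal_observation M P V W Y X)
  (hA : log_norm (mA M) < 0)
  (hP : exists c : R, forall (k l : nat) (j1 j2 : 'I_dx),
          `|kb_cov M l k j1 j2| <= c)
  (q : R) (hq : 1 <= q) (t k1 l : nat) :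
  exists K : R, forall (N : nat), (2 <= N)%N ->
    forall (xi0 : 'I_N -> T -> 'cV[R]_dx)
      (Wb : 'I_N -> R -> T -> 'cV[R]_dx) (Vb : 'I_N -> R -> T -> 'cV[R]_dy),
    ensemble_noise M P Y X xi0 Wb Vb ->
    ('E_P[fun w : T =>
        (`|U_enkf M l t k1 (fun s => Y s w) (fun i => xi0 i w)
             (fun i s => Wb i s w) (fun i s => Vb i s w)
           - U_limit M l t k1 (fun s => Y s w)| `^ q)%R] `^ q^-1
     <= (K / Num.sqrt N%:R)%:E)%E.
Proof.
have q_gt0 : 0 < q by exact: lt_le_trans hq.
have [tU tU0 tD] := log_estimate_close hYX l (t * 2 ^ l + k1).
have [p qp] := filter_ex (nbhs_infty_ger q).
have [C hC] := tD.2 p.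
exists ((1 + `|C|) `^ q^-1) => N N2 xi0 Wb Vb noise.
pose E := Ensemble N2 noise.
have := hC E; have := tame1_measurable (tame1_of E tD).
have := tame1_measurable (tame1_of E tU); have := tame1_measurable (tame1_of E tU0).
rewrite /= -/(U_limit _ _ _ _ _).
set U0 := fun w => _; set U := fun w => _; set D := fun w => _.
move=> mU0 mU mD momD.
have s0 : 0 < Num.sqrt N%:R :> R by rewrite sqrtr_gt0 ltr0n (leq_trans _ N2).
have bound : ('E_P[fun w => (`|U w - U0 w| `^ q)%R] <=
    ((Num.sqrt N%:R)^-1 `^ q * (1 + `|C|))%:E)%E.
  rewrite unlock; apply: (integral_le_bound (a := fun=> 1)
    (b := fun w => `|D w| ^+ p)) => //.
  - apply: (measurableT_comp (measurable_powR q)).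
    by apply: measurableT_comp => //; exact: measurable_funB.
  - exact: measurable_abs_expn.
  - move=> w; have -> : `|U w - U0 w| = (Num.sqrt N%:R)^-1 * `|D w|.
      by rewrite /D normrM (gtr0_norm s0) mulKf ?gt_eqF.
    rewrite powRM ?invr_ge0 ?(ltW s0)// ler_wpM2l ?powR_ge0//.
    by rewrite powR_le_1D_expn// ltW.
  - by rewrite integral_cst//= probability_setT mule1.
  - by apply: (le_trans momD); rewrite lee_fin ler_norm.
have C0 : 0 <= 1 + `|C| by rewrite addr_ge0.
apply: (@le_trans _ _ (((Num.sqrt N%:R)^-1 `^ q * (1 + `|C|))%:E `^ q^-1)%E).
  apply: gt0_ler_poweR => //; rewrite ?invr_ge0 ?(ltW q_gt0)//.
  - rewrite in_itv/= leey andbT; apply: expectation_ge0 => w; exact: powR_ge0.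
  - by rewrite in_itv/= leey andbT lee_fin mulr_ge0 ?powR_ge0.
rewrite poweR_EFin lee_fin powRM ?powR_ge0// -powRrM divff ?gt_eqF//.
by rewrite powRr1 ?invr_ge0 ?(ltW s0)// mulrC.
Qed.
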